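(* Let $\{a_n\}_{n=0}^\infty$ be a sequence of complex numbers with $\sup_n |a_n|<\infty$, and let $f(z)=\sum_{n=0}^\infty a_n z^n$ for $z\in\mathbb{D}$. Suppose $I\subset\partial\mathbb{D}$ is an open interval such that $$\sup_{0<r<1}\int_{e^{i\theta}\in I}|f(re^{i\theta})|\,\frac{d\theta}{2\pi}<\infty .$$ Then every right limit of $\{a_n\}_{n=0}^\infty$ is reflectionless on $I$.
   Context: $\mathbb{D}=\{z\in\mathbb{C}: |z|<1\}$, $\partial\mathbb{D}$ is the unit circle, and an open interval $I\subset\partial\mathbb{D}$ means a nonempty open arc. Right limit: for a bounded sequence $\{a_n\}_{n=0}^\infty$, a right limit is a two-sided sequence $\{b_n\}_{n=-\infty}^\infty$ for which there is a sequence of integers $n_j\to\infty$ with $b_n=\lim_{j\to\infty} a_{n+n_j}$ for every $n\in\mathbb{Z}$. Reflectionless: for a bounded two-sided sequence $\{b_n\}_{n=-\infty}^\infty$, put $f_+(z)=\sum_{n=0}^\infty b_n z^n$ for $z\in\mathbb{D}$ and $f_-(z)=\sum_{n=-\infty}^{-1} b_n z^n$ for $z\in(\mathbb{C}\cup\{\infty\})\setminus\overline{\mathbb{D}}$. The sequence is reflectionless on an open interval $I\subset\partial\mathbb{D}$ if and only if $f_+$ has an analytic continuation from $\mathbb{D}$ to $(\mathbb{C}\cup\{\infty\})\setminus(\partial\mathbb{D}\setminus I)$ such that on $(\mathbb{C}\cup\{\infty\})\setminus\overline{\mathbb{D}}$ the continuation satisfies $f_+(z)+f_-(z)=0$. 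*)

(* Defs.v *)
From Stdlib Require Import Reals ZArith.
From Coquelicot Require Import Coquelicot.
Open Scope R_scope.

(** Sum of a series of complex numbers; as for Coquelicot's [Lim] or [RInt],
    the value is meaningful only when the series converges. *)
Definition CSeries (u : nat -> C) : C :=
  iota (T := C_CompleteNormedModule)
    (is_series (K := C_AbsRing) (V := C_NormedModule) u).

Definition Cpower_series (a : nat -> C) (z : C) : C :=
  CSeries (fun n => (a n * z ^ n)%C).

(** [e^{i theta}] *)
Definition expi (theta : R) : C := (cos theta, sin theta).

(** For [alpha < beta <= alpha + 2 PI] this is a nonempty open arc of the unit
    circle, and [theta |-> expi theta] maps [(alpha, beta)] bijectively onto it. *)
Definition open_arc (alpha beta : R) (z : C) : Prop :=
  exists theta : R, alpha < theta < beta /\ z = expi theta.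

(** The Riemann sphere. *)
Inductive Csphere : Set :=
  | Cfin (z : C)
  | Cinf.

(** [w |-> 1/w] as a map to the sphere: the chart at infinity. *)
Definition Csphere_inv (w : C) : Csphere :=
  if Ceq_dec w 0 then Cinf else Cfin (/ w)%C.

Definition holomorphic_at (g : C -> C) (z : C) : Prop :=
  locally (T := C_UniformSpace) z
    (fun w => ex_derive (K := C_AbsRing) (V := C_NormedModule) g w).

Definition analytic_at (F : Csphere -> C) (p : Csphere) : Prop :=
  match p with
  | Cfin z => holomorphic_at (fun w => F (Cfin w)) z
  | Cinf => holomorphic_at (fun w => F (Csphere_inv w)) 0
  end.

(** The sphere with [(unit circle) \ I] removed. *)
Definition slit_sphere (I : C -> Prop) (p : Csphere) : Prop :=
  match p with
  | Cfin z => ~ (Cmod z = 1 /\ ~ I z)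
  | Cinf => True
  end.

(** The complement of the closed unit disk in the sphere. *)
Definition exterior_disk (p : Csphere) : Prop :=
  match p with
  | Cfin z => 1 < Cmod z
  | Cinf => True
  end.

Definition f_plus (b : Z -> C) (z : C) : C :=
  Cpower_series (fun n => b (Z.of_nat n)) z.

(** The sum over [n <= -1] is indexed by [n = - (k + 1)]; at infinity every
    term [b n * z ^ n] with [n <= -1] vanishes. *)
Definition f_minus (b : Z -> C) (p : Csphere) : C :=
  match p with
  | Cfin z => CSeries (fun k => (b (- Z.of_nat (S k))%Z * / z ^ (S k))%C)
  | Cinf => 0
  end.

Definition bounded_seq {T : Type} (u : T -> C) : Prop :=
  exists M : R, forall n : T, Cmod (u n) <= M.

(** [Z.to_nat] truncates negative indices to [0], which affects only finitely
    many [j] for each [n] since [nj] tends to infinity. *)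
Definition right_limit (a : nat -> C) (b : Z -> C) : Prop :=
  exists nj : nat -> Z,
    is_lim_seq (fun j => IZR (nj j)) p_infty /\
    forall n : Z,
      filterlim (fun j => a (Z.to_nat (n + nj j))) eventually
        (locally (T := C_UniformSpace) (b n)).

Definition reflectionless (b : Z -> C) (I : C -> Prop) : Prop :=
  bounded_seq b /\
  exists F : Csphere -> C,
    (forall p : Csphere, slit_sphere I p -> analytic_at F p) /\
    (forall z : C, Cmod z < 1 -> F (Cfin z) = f_plus b z) /\
    (forall p : Csphere, exterior_disk p -> (F p + f_minus b p)%C = 0).

(* Main.v *)
Require Import Defs.
From Stdlib Require Import Reals ZArith Lra Lia List Classical_Prop.
From Coquelicot Require Import Coquelicot.
Open Scope R_scope.

(** Write [e_n] for the function [x -> e^{i n x}] and let [B = sum_n b n e_n], a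
    distribution on the circle. Inside the disc [f_plus b] is the Cauchy transform
    of [B], and outside it the Cauchy transform of [B] is [- f_minus b]. So [b] is
    reflectionless on the arc as soon as [B] vanishes there: the Cauchy transform
    is analytic off the support of [B].

    Why [B] vanishes on the arc. Let [phi] be a test function supported in the arc
    and let [mu k] be the moment of [phi f e_k], with [f] taken in the limit of
    radius 1. Pairing [phi] with a shift of [a] by [s] gives [mu (- s)], and [B]
    is a limit of such shifts, so it is enough that [mu (- s)] tends to 0 as [s]
    tends to infinity. In the other direction [mu k -> 0] is clear, because [f]
    has only nonnegative frequencies. The [L^1] hypothesis says that [mu], as a
    functional on trigonometric polynomials, is bounded for the sup norm
    ([moment_twist_radial]). For such functionals decay in one direction implies
    decay in the other; this is [one_sided_decay], the heart of the proof. It is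
    obtained by perturbing an almost extremal polynomial of the unit ball by an
    approximate disc automorphism ([disc_perturbation]).

    The test functions are triangles ([hat]). Their Fourier coefficients decay
    like [1 / n ^ 2], so all series converge absolutely, and pairing [B] with a
    triangle is taking a second difference of the second primitive [prim b] of
    [B - b 0]. Vanishing of [B] thus says that the continuous function
    [prim b + b 0 x ^ 2 / 2] has zero second differences on the arc, that is, it
    is affine there ([second_diff_zero_affine]).

    For the continuation, the Cauchy transform of [B] is written as an integral
    over the circle of [prim b] against the second derivative of the Cauchy kernel
    ([cauchy_transform_series]). On the arc [prim b] is a quadratic polynomial, and
    integration by parts reduces that part of the integral to boundary terms
    ([continuation_off_circle]). What remains is an integral over the complementary
    arc and two boundary terms, a single formula that is visibly analytic on the
    whole slit sphere, the point at infinity included ([smooth_family],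
    [continuation_analytic_fin], [continuation_analytic_inf]). *)

(** * Limits and series of complex numbers *)

Definition tends (u : nat -> C) (l : C) : Prop :=
  forall eps : R, 0 < eps ->
  exists N : nat, forall n : nat, (N <= n)%nat -> Cmod (u n - l)%C < eps.

Definition Csum (u : nat -> C) (n : nat) : C := sum_n (G := C_AbelianMonoid) u n.

Definition sums (u : nat -> C) (l : C) : Prop := tends (Csum u) l.

Lemma Csum_0 u : Csum u 0 = u 0%nat.
Proof. apply (sum_O (G := C_AbelianMonoid)). Qed.

Lemma Csum_S u n : Csum u (S n) = (Csum u n + u (S n))%C.
Proof. apply (sum_Sn (G := C_AbelianMonoid)). Qed.

Lemma Csum_ext u v n :
  (forall k, (k <= n)%nat -> u k = v k) -> Csum u n = Csum v n.
Proof.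
induction n as [|n IH]; intros H.
- rewrite !Csum_0. now apply H.
- rewrite !Csum_S, IH; [now rewrite (H (S n)) by lia | intros k Hk; apply H; lia].
Qed.

Lemma Csum_mult c u n : (c * Csum u n)%C = Csum (fun k => (c * u k)%C) n.
Proof.
induction n as [|n IH]; [now rewrite !Csum_0 | ].
rewrite !Csum_S, <- IH. ring.
Qed.

Lemma Csum_shift u n : Csum u (S n) = (u 0%nat + Csum (fun k => u (S k)) n)%C.
Proof.
induction n as [|n IH]; [now rewrite Csum_S, !Csum_0 | ].
rewrite Csum_S, IH, Csum_S. ring.
Qed.

Lemma tends_filterlim u l :
  filterlim u eventually (locally (T := C_UniformSpace) l) <-> tends u l.
Proof.
split.
- intros H eps Heps.
  assert (He : 0 < eps / sqrt 2) by (apply Rdiv_lt_0_compat; [lra | apply sqrt_lt_R0; lra]).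
  destruct (H (ball (M := C_UniformSpace) l (mkposreal _ He))) as [N HN].
  { now exists (mkposreal _ He). }
  exists N; intros n Hn.
  generalize (C_NormedModule_mixin_compat2 l (u n) (mkposreal _ He) (HN n Hn)).
  simpl. intros H1. change (minus (u n) l) with (u n - l)%C in H1.
  replace (sqrt 2 * (eps / sqrt 2)) with eps in H1; [exact H1 | ].
  field. apply Rgt_not_eq, sqrt_lt_R0; lra.
- intros H P [eps HP].
  destruct (H eps (cond_pos eps)) as [N HN].
  exists N; intros n Hn. apply HP.
  apply C_NormedModule_mixin_compat1. now apply HN.
Qed.

Lemma sums_is_series u l :
  is_series (K := C_AbsRing) (V := C_NormedModule) u l <-> sums u l.
Proof. apply tends_filterlim. Qed.

Lemma Cmod_sub_sym x y : Cmod (x - y)%C = Cmod (y - x)%C.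
Proof. rewrite <- Cmod_opp. f_equal. ring. Qed.

Lemma Cmod_sub_triangle x y z : Cmod (x - z)%C <= Cmod (x - y)%C + Cmod (y - z)%C.
Proof.
replace (x - z)%C with ((x - y) + (y - z))%C by ring. apply Cmod_triangle.
Qed.

Lemma Cmod_sub_le x y : Cmod x <= Cmod y + Cmod (x - y)%C.
Proof.
replace x with (y + (x - y))%C at 1 by ring. apply Cmod_triangle.
Qed.

Lemma tends_unique u l l' : tends u l -> tends u l' -> l = l'.
Proof.
intros H H'. destruct (Ceq_dec l l') as [|Hne]; [assumption | exfalso].
assert (Hd : 0 < Cmod (l - l')%C).
{ apply Cmod_gt_0. now apply Cminus_eq_contra. }
destruct (H (Cmod (l - l')%C / 2)) as [N HN]; [lra | ].
destruct (H' (Cmod (l - l')%C / 2)) as [N' HN']; [lra | ].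
specialize (HN (max N N') (Nat.le_max_l _ _)).
specialize (HN' (max N N') (Nat.le_max_r _ _)).
generalize (Cmod_sub_triangle l (u (max N N')) l'). rewrite (Cmod_sub_sym l (u _)). lra.
Qed.

Lemma tends_const c : tends (fun _ => c) c.
Proof.
intros eps Heps. exists 0%nat. intros n _.
replace (c - c)%C with (RtoC 0) by ring. now rewrite Cmod_0.
Qed.

Lemma tends_plus u v l m :
  tends u l -> tends v m -> tends (fun n => u n + v n)%C (l + m)%C.
Proof.
intros H H' eps Heps.
destruct (H (eps / 2)) as [N HN]; [lra | ].
destruct (H' (eps / 2)) as [N' HN']; [lra | ].
exists (max N N'). intros n Hn.
specialize (HN n ltac:(lia)). specialize (HN' n ltac:(lia)).
replace (u n + v n - (l + m))%C with ((u n - l) + (v n - m))%C by ring.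
generalize (Cmod_triangle (u n - l)%C (v n - m)%C). lra.
Qed.

Lemma tends_scal c u l : tends u l -> tends (fun n => c * u n)%C (c * l)%C.
Proof.
intros H eps Heps.
generalize (Cmod_ge_0 c); intros Hc.
destruct (H (eps / (Cmod c + 1))) as [N HN]; [apply Rdiv_lt_0_compat; lra | ].
exists N. intros n Hn. specialize (HN n Hn).
replace (c * u n - c * l)%C with (c * (u n - l))%C by ring.
rewrite Cmod_mult.
apply Rle_lt_trans with ((Cmod c) * (eps / (Cmod c + 1))).
- apply Rmult_le_compat_l; lra.
- apply Rlt_le_trans with ((Cmod c + 1) * (eps / (Cmod c + 1))).
  + apply Rmult_lt_compat_r; [apply Rdiv_lt_0_compat | ]; lra.
  + right. field. lra.
Qed.

Lemma tends_ext u v l : (forall n, u n = v n) -> tends u l -> tends v l.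
Proof.
intros E H eps Heps. destruct (H eps Heps) as [N HN].
exists N. intros n Hn. rewrite <- E. now apply HN.
Qed.

Lemma tends_subseq u l (s : nat -> nat) :
  (forall K, exists J, forall j, (J <= j)%nat -> (K <= s j)%nat) ->
  tends u l -> tends (fun j => u (s j)) l.
Proof.
intros Hs H eps Heps. destruct (H eps Heps) as [N HN].
destruct (Hs N) as [J HJ]. exists J. intros j Hj. now apply HN, HJ.
Qed.

Lemma tends_Cmod_le u l B : tends u l -> (forall n, Cmod (u n) <= B) -> Cmod l <= B.
Proof.
intros H HB. apply Rnot_lt_le. intros Hlt.
destruct (H (Cmod l - B)) as [N HN]; [lra | ].
specialize (HN N (Nat.le_refl _)). rewrite Cmod_sub_sym in HN.
generalize (Cmod_sub_le l (u N)) (HB N). lra.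
Qed.

Lemma CSeries_eq u l : sums u l -> CSeries u = l.
Proof.
intros H. unfold CSeries.
assert (H1 := iota_correct (V := C_CompleteNormedModule)
  (is_series (K := C_AbsRing) (V := C_NormedModule) u)).
apply (tends_unique (Csum u)); [ | exact H].
apply sums_is_series, H1. exists l. split.
- now apply sums_is_series.
- intros l' H'. apply (tends_unique (Csum u)); [exact H | now apply sums_is_series].
Qed.

(** * Dominated series *)

Definition nonneg_series (y : nat -> R) (Y : R) : Prop :=
  (forall n, 0 <= y n) /\ is_series y Y.

Lemma nonneg_series_tail y Y :
  nonneg_series y Y -> forall eps, 0 < eps ->
  exists N, forall n, (N <= n)%nat -> Y - sum_n y n < eps.
Proof.
intros [_ H] eps Heps.
destruct (H (ball Y (mkposreal _ Heps))) as [N HN]; [now exists (mkposreal _ Heps) | ].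
exists N. intros n Hn. specialize (HN n Hn).
change (Rabs (sum_n y n - Y) < eps) in HN. apply Rabs_def2 in HN. lra.
Qed.

Lemma Csum_diff_le u y n m :
  (forall k, Cmod (u k) <= y k) -> (n <= m)%nat ->
  Cmod (Csum u m - Csum u n)%C <= sum_n y m - sum_n y n.
Proof.
intros Hu. induction m as [|m IH]; intros Hnm.
- replace n with 0%nat by lia.
  replace (Csum u 0 - Csum u 0)%C with (RtoC 0) by ring. rewrite Cmod_0. lra.
- destruct (Nat.eq_dec n (S m)) as [->|Hne].
  + replace (Csum u (S m) - Csum u (S m))%C with (RtoC 0) by ring. rewrite Cmod_0. lra.
  + rewrite Csum_S, sum_Sn. change (plus (sum_n y m) (y (S m))) with (sum_n y m + y (S m)).
    replace (Csum u m + u (S m) - Csum u n)%C with ((Csum u m - Csum u n) + u (S m))%C by ring.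
    generalize (Cmod_triangle (Csum u m - Csum u n)%C (u (S m))) (IH ltac:(lia)) (Hu (S m)). lra.
Qed.

Lemma nonneg_series_sum_le y Y n : nonneg_series y Y -> sum_n y n <= Y.
Proof.
intros HY. apply Rnot_lt_le. intros Hlt.
destruct (nonneg_series_tail y Y HY (sum_n y n - Y)) as [N HN]; [lra | ].
assert (Hmono : forall k, sum_n y n <= sum_n y (n + k)).
{ induction k as [|k IH]; [rewrite Nat.add_0_r; lra | ].
  rewrite Nat.add_succ_r, sum_Sn.
  change (plus (sum_n y (n + k)) (y (S (n + k)))) with (sum_n y (n + k) + y (S (n + k))).
  generalize (proj1 HY (S (n + k))). lra. }
destruct HY as [Hy HY].
destruct (HY (ball Y (mkposreal (sum_n y n - Y) ltac:(lra)))) as [K HK].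
{ now exists (mkposreal (sum_n y n - Y) ltac:(lra)). }
specialize (HK (n + K)%nat ltac:(lia)).
change (Rabs (sum_n y (n + K) - Y) < sum_n y n - Y) in HK.
apply Rabs_def2 in HK. specialize (Hmono K). lra.
Qed.

Lemma dominated_sums u y Y :
  nonneg_series y Y -> (forall k, Cmod (u k) <= y k) -> exists s, sums u s.
Proof.
intros [Hy HY] Hu.
destruct (ex_series_le (K := C_AbsRing) (V := C_CompleteNormedModule) u y) as [s Hs].
- exact Hu.
- now exists Y.
- exists s. now apply sums_is_series.
Qed.

Lemma dominated_tail u s y Y n :
  nonneg_series y Y -> (forall k, Cmod (u k) <= y k) -> sums u s ->
  Cmod (s - Csum u n)%C <= Y - sum_n y n.
Proof.
intros HY Hu Hs. apply Rnot_lt_le. intros Hlt.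
destruct (Hs (Cmod (s - Csum u n)%C - (Y - sum_n y n))) as [N HN]; [lra | ].
specialize (HN (N + n)%nat ltac:(lia)).
generalize (Csum_diff_le u y n (N + n) Hu ltac:(lia)).
generalize (nonneg_series_sum_le y Y (N + n) HY).
generalize (Cmod_sub_triangle s (Csum u (N + n)) (Csum u n)).
rewrite (Cmod_sub_sym s (Csum u (N + n))). lra.
Qed.

Lemma tends_Csum (u : nat -> nat -> C) v n :
  (forall k, tends (fun j => u j k) (v k)) -> tends (fun j => Csum (u j) n) (Csum v n).
Proof.
intros H. induction n as [|n IH].
- apply (tends_ext (fun j => u j 0%nat)); [intros j; now rewrite Csum_0 | ].
  rewrite Csum_0. apply H.
- apply (tends_ext (fun j => Csum (u j) n + u j (S n))%C); [intros j; now rewrite Csum_S | ].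
  rewrite Csum_S. apply tends_plus; [exact IH | apply H].
Qed.

(** Tannery's theorem: a finite head converges termwise, and the tails are
    uniformly small because the majorant [y] is summable. *)
Lemma tannery (u : nat -> nat -> C) (s : nat -> C) v t y Y :
  nonneg_series y Y -> (forall j k, Cmod (u j k) <= y k) ->
  (forall k, tends (fun j => u j k) (v k)) ->
  (forall j, sums (u j) (s j)) -> sums v t -> tends s t.
Proof.
intros HY Hu Huv Hs Ht eps Heps.
assert (Hv : forall k, Cmod (v k) <= y k).
{ intros k. apply (tends_Cmod_le _ _ _ (Huv k)). intros j. apply Hu. }
destruct (nonneg_series_tail y Y HY (eps / 3)) as [K HK]; [lra | ].
specialize (HK K (Nat.le_refl _)).
destruct (tends_Csum u v K Huv (eps / 3)) as [J HJ]; [lra | ].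
exists J. intros j Hj. specialize (HJ j Hj).
generalize (dominated_tail _ _ _ _ K HY (Hu j) (Hs j)).
generalize (dominated_tail _ _ _ _ K HY Hv Ht).
generalize (Cmod_sub_triangle (s j) (Csum (u j) K) t).
generalize (Cmod_sub_triangle (Csum (u j) K) (Csum v K) t).
rewrite (Cmod_sub_sym (Csum v K) t). lra.
Qed.

Lemma sums_plus u v l m :
  sums u l -> sums v m -> sums (fun n => u n + v n)%C (l + m)%C.
Proof.
intros H H'. unfold sums.
apply (tends_ext (fun n => Csum u n + Csum v n)%C); [ | now apply tends_plus].
induction n as [|n IH]; [now rewrite !Csum_0 | ].
rewrite !Csum_S, <- IH. ring.
Qed.

Lemma sums_scal c u l : sums u l -> sums (fun n => c * u n)%C (c * l)%C.
Proof.
intros H. unfold sums.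
apply (tends_ext (fun n => c * Csum u n)%C); [ | now apply tends_scal].
intros n. apply Csum_mult.
Qed.

Lemma sums_ext u v l : (forall n, u n = v n) -> sums u l -> sums v l.
Proof.
intros E. apply tends_ext. intros n. apply Csum_ext. intros k _. apply E.
Qed.

Lemma sums_incr u l : sums u l <-> sums (fun k => u (S k)) (l - u 0%nat)%C.
Proof.
split; intros H eps Heps; destruct (H eps Heps) as [N HN].
- exists N. intros n Hn. specialize (HN (S n) ltac:(lia)).
  rewrite Csum_shift in HN.
  replace (Csum (fun k => u (S k)) n - (l - u 0%nat))%C
    with (u 0%nat + Csum (fun k => u (S k)) n - l)%C by ring. exact HN.
- exists (S N). intros n Hn. destruct n as [|n]; [lia | ].
  rewrite Csum_shift. specialize (HN n ltac:(lia)).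
  replace (u 0%nat + Csum (fun k => u (S k)) n - l)%C
    with (Csum (fun k => u (S k)) n - (l - u 0%nat))%C by ring. exact HN.
Qed.

(** The majorant used for all Fourier series below: triangles have Fourier
    coefficients of order [1 / k ^ 2], and so have second primitives. *)
Definition invsq (k : nat) : R := / (INR k + 1) ^ 2.

Lemma invsq_nonneg_series A : 0 <= A -> exists Y, nonneg_series (fun k => A * invsq k) Y.
Proof.
intros HA.
assert (Hpos : forall k, 0 <= invsq k).
{ intros k. unfold invsq. left. apply Rinv_0_lt_compat, pow_lt.
  generalize (pos_INR k). lra. }
assert (Hsum : ex_series invsq).
{ (* comparison with a telescoping series *)
  apply (ex_series_le (V := R_CompleteNormedModule) invsq
    (fun k => 2 * (/ (INR k + 1) - / (INR (S k) + 1)))).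
  - intros k. change (norm (invsq k)) with (Rabs (invsq k)).
    rewrite Rabs_pos_eq by apply Hpos. unfold invsq. rewrite S_INR.
    generalize (pos_INR k). intros Hk. set (x := INR k + 1). assert (Hx : 1 <= x) by (unfold x; lra).
    replace (2 * (/ x - / (x + 1))) with (2 / (x * (x + 1))) by (field; lra).
    replace (2 / (x * (x + 1)) ) with (/ (x * (x + 1) / 2)) by (field; lra).
    apply Rinv_le_contravar; nra.
  - exists (2 * 1). apply (is_series_scal_l (K := R_AbsRing) 2 (fun k => / (INR k + 1) - / (INR (S k) + 1))).
    assert (E : forall n, sum_n (fun k => / (INR k + 1) - / (INR (S k) + 1)) n = 1 - / (INR (S n) + 1)).
    { induction n as [|n IH].
      - rewrite sum_O. simpl. lra.
      - rewrite sum_Sn, IH. change plus with Rplus. lra. }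
    apply (is_lim_seq_ext (fun n => 1 - / (INR (S n) + 1)) _ 1); [intros n; now rewrite E | ].
    replace (Finite 1) with (Rbar_minus 1 0) by (simpl; f_equal; ring).
    apply is_lim_seq_minus with (Finite 1) (Finite 0); [apply is_lim_seq_const | | reflexivity].
    apply (is_lim_seq_incr_1 (fun n => / (INR n + 1))).
    replace (Finite 0) with (Rbar_inv p_infty) by reflexivity.
    apply is_lim_seq_inv; [ | discriminate].
    apply is_lim_seq_plus with p_infty (Finite 1); [apply is_lim_seq_INR | apply is_lim_seq_const | reflexivity]. }
destruct Hsum as [Y HY]. exists (A * Y). split.
- intros k. apply Rmult_le_pos; auto.
- exact (is_series_scal_l (K := R_AbsRing) A invsq Y HY).
Qed.

Lemma geom_nonneg_series A r : 0 <= A -> 0 <= r < 1 -> exists Y, nonneg_series (fun k => A * r ^ k) Y.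
Proof.
intros HA Hr. exists (A * / (1 - r)). split.
- intros k. apply Rmult_le_pos; [lra | apply pow_le; lra].
- apply (is_series_scal_l (K := R_AbsRing) A (fun k => r ^ k)). apply is_series_geom.
  rewrite Rabs_pos_eq; lra.
Qed.

(** * Trigonometric polynomials and one-sided decay *)

Definition expk (k : Z) (theta : R) : C := expi (IZR k * theta).

Lemma expi_plus x y : expi (x + y) = (expi x * expi y)%C.
Proof.
unfold expi, Cmult; simpl. rewrite cos_plus, sin_plus. f_equal; ring.
Qed.

Lemma Cmod_expi x : Cmod (expi x) = 1.
Proof.
unfold Cmod, expi; simpl. generalize (sin2_cos2 x). unfold Rsqr. intros H.
replace (cos x * (cos x * 1) + sin x * (sin x * 1)) with 1 by lra. apply sqrt_1.
Qed.

Lemma expi_neq_0 x : expi x <> 0.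
Proof. apply Cmod_gt_0. rewrite Cmod_expi. lra. Qed.

Lemma expi_0 : expi 0 = 1.
Proof. unfold expi. now rewrite cos_0, sin_0. Qed.

Lemma expi_opp x : expi (- x) = Cconj (expi x).
Proof. unfold expi, Cconj; simpl. now rewrite cos_neg, sin_neg. Qed.

Lemma expk_0 x : expk 0 x = 1.
Proof. unfold expk. rewrite Rmult_0_l. apply expi_0. Qed.

Lemma expk_plus k l x : expk (k + l) x = (expk k x * expk l x)%C.
Proof. unfold expk. rewrite plus_IZR, Rmult_plus_distr_r. apply expi_plus. Qed.

Lemma expk_opp k x : expk (- k) x = Cconj (expk k x).
Proof. unfold expk. rewrite opp_IZR, Ropp_mult_distr_l_reverse. apply expi_opp. Qed.

Lemma Cmod_expk k x : Cmod (expk k x) = 1.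
Proof. apply Cmod_expi. Qed.

Definition trigpoly : Type := list (Z * C).

Definition eval (p : trigpoly) (theta : R) : C :=
  fold_right (fun kc s => snd kc * expk (fst kc) theta + s)%C (RtoC 0) p.

Definition moment (mu : Z -> C) (p : trigpoly) : C :=
  fold_right (fun kc s => snd kc * mu (fst kc) + s)%C (RtoC 0) p.

Definition monomul (k : Z) (c : C) (p : trigpoly) : trigpoly :=
  map (fun ld => ((k + fst ld)%Z, (c * snd ld)%C)) p.

Definition polymul (p q : trigpoly) : trigpoly :=
  flat_map (fun kc => monomul (fst kc) (snd kc) q) p.

Lemma eval_cons k c p x : eval ((k, c) :: p) x = (c * expk k x + eval p x)%C.
Proof. reflexivity. Qed.

Lemma moment_cons mu k c p : moment mu ((k, c) :: p) = (c * mu k + moment mu p)%C.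
Proof. reflexivity. Qed.

Lemma eval_app p q x : eval (p ++ q) x = (eval p x + eval q x)%C.
Proof.
induction p as [|kc p IH]; simpl; [ring | rewrite IH; ring].
Qed.

Lemma moment_app mu p q : moment mu (p ++ q) = (moment mu p + moment mu q)%C.
Proof.
induction p as [|kc p IH]; simpl; [ring | rewrite IH; ring].
Qed.

Lemma eval_monomul k c p x : eval (monomul k c p) x = (c * expk k x * eval p x)%C.
Proof.
induction p as [|ld p IH]; simpl; [ring | rewrite IH, expk_plus; ring].
Qed.

Lemma eval_polymul p q x : eval (polymul p q) x = (eval p x * eval q x)%C.
Proof.
induction p as [|kc p IH]; simpl; [ring | ].
rewrite eval_app, IH, eval_monomul. ring.
Qed.

Lemma moment_monomul_0 mu c p : moment mu (monomul 0 c p) = (c * moment mu p)%C.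
Proof.
induction p as [|ld p IH]; simpl; [ring | rewrite IH; ring].
Qed.

Lemma tends_moment (nu : nat -> Z -> C) mu p :
  (forall k, tends (fun n => nu n k) (mu k)) -> tends (fun n => moment (nu n) p) (moment mu p).
Proof.
intros H. induction p as [|ld p IH]; simpl; [apply tends_const | ].
apply tends_plus; [apply tends_scal, H | exact IH].
Qed.

Lemma moment_zero p : moment (fun _ => RtoC 0) p = 0.
Proof. induction p as [|ld p IH]; simpl; [reflexivity | rewrite IH; ring]. Qed.

Lemma moment_shift mu k c p :
  moment mu (monomul k c p) = (c * moment (fun l => mu (k + l)%Z) p)%C.
Proof.
induction p as [|ld p IH]; simpl; [ring | rewrite IH; ring].
Qed.

Lemma moment_shift_tends_0 mu p :
  tends (fun n => mu (Z.of_nat n)) 0 ->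
  tends (fun n => moment (fun l => mu (Z.of_nat n + l)%Z) p) 0.
Proof.
intros H. rewrite <- (moment_zero p).
apply (tends_moment (fun n l => mu (Z.of_nat n + l)%Z)). intros l eps Heps.
destruct (H eps Heps) as [N HN].
exists (N + Z.to_nat (Z.abs l))%nat. intros n Hn.
replace (Z.of_nat n + l)%Z with (Z.of_nat (Z.to_nat (Z.of_nat n + l))) by lia.
apply HN. lia.
Qed.

Lemma Cmod_sqr z : Cmod z ^ 2 = fst z ^ 2 + snd z ^ 2.
Proof. apply Cmod2_alt. Qed.

(** [psi + conj s - s psi^2] is the disc automorphism
    [psi -> (psi + conj s) / (1 + s psi)] expanded to first order in [s]. It can
    therefore move [psi] by order [|s|], but push it out of the closed unit disc
    only by order [|s| ^ 2]. *)
Lemma disc_perturbation psi s :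
  Cmod psi <= 1 -> Cmod s <= / 2 ->
  Cmod (psi + (Cconj s - s * (psi * psi)))%C <= 1 + 2 * Cmod s ^ 2.
Proof.
intros Hpsi Hs.
generalize (Cmod_ge_0 psi) (Cmod_ge_0 s); intros H0 H1.
apply Rsqr_incr_0_var; [ | nra].
apply Rle_trans with (1 + 4 * Cmod s ^ 2); [ | unfold Rsqr; nra].
assert (E : Rsqr (Cmod (psi + (Cconj s - s * (psi * psi)))%C) =
  Cmod psi ^ 2 + 2 * (1 - Cmod psi ^ 2) * Re (s * psi)%C
  + Cmod (Cconj s - s * (psi * psi))%C ^ 2).
{ replace (Rsqr (Cmod (psi + (Cconj s - s * (psi * psi)))%C)) with
    (Cmod (psi + (Cconj s - s * (psi * psi)))%C ^ 2) by (unfold Rsqr; ring).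
  rewrite !Cmod_sqr. destruct psi as [a b], s as [c d]; unfold Re; simpl. ring. }
rewrite E.
assert (Hre : Re (s * psi)%C <= Cmod s * Cmod psi).
{ rewrite <- Cmod_mult. generalize (re_le_Cmod (s * psi)%C) (Rle_abs (Re (s * psi)%C)). lra. }
assert (Hd : Cmod (Cconj s - s * (psi * psi))%C <= 2 * Cmod s).
{ generalize (Cmod_triangle (Cconj s) (- (s * (psi * psi)))%C).
  rewrite Cmod_opp, Cmod_conj, !Cmod_mult. unfold Cminus. intros Ht.
  assert (Cmod psi * Cmod psi <= 1) by nra. nra. }
assert (Hd2 : Cmod (Cconj s - s * (psi * psi))%C ^ 2 <= 4 * Cmod s ^ 2).
{ generalize (Cmod_ge_0 (Cconj s - s * (psi * psi))%C). nra. }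
assert (Hx : 0 <= 1 - Cmod psi ^ 2) by nra.
assert (H2 : Re (s * psi)%C <= / 2) by nra.
nra.
Qed.

Lemma unimodular_phase z : exists w, Cmod w = 1 /\ (w * z)%C = RtoC (Cmod z).
Proof.
destruct (Ceq_dec z 0) as [->|Hz].
- exists (RtoC 1). split; [apply Cmod_1 | rewrite Cmod_0; ring].
- assert (Hm := proj1 (Cmod_gt_0 z) Hz).
  exists (Cconj z / Cmod z)%C.
  assert (Hm' : RtoC (Cmod z) <> 0) by (intros E; apply RtoC_inj in E; lra).
  split.
  + rewrite Cmod_div by assumption.
    rewrite Cmod_conj, Cmod_R, Rabs_pos_eq by lra. field. lra.
  + replace (Cconj z / Cmod z * z)%C with ((z * Cconj z) / Cmod z)%C by (field; assumption).
    rewrite <- Cmod2_conj. rewrite <- RtoC_div by lra. f_equal. field. lra.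
Qed.

Lemma Re_le_Cmod z : Re z <= Cmod z.
Proof. generalize (re_le_Cmod z) (Rle_abs (Re z)). lra. Qed.

(** For a measure on the circle this says that Fourier coefficients tending to
    zero in one direction tend to zero in the other (Rajchman). Let [S] be the
    supremum of [Re mu(psi)] over trigonometric polynomials [psi] of sup norm
    at most 1, let [psi] be almost extremal, and suppose [|mu(e_{-n})| >= delta]
    for arbitrarily large [n]. Perturb [psi] to
    [psi + v w e_{-n} - v (conj w) e_n psi^2] with [w] unimodular such that
    [w mu(e_{-n}) > 0]. The second term gains [v delta]; the third one, which
    keeps the polynomial close to the unit ball, costs almost nothing, because
    [e_n psi^2] only has frequencies near [n] and [mu] decays there. By
    [disc_perturbation] the sup norm grows by order [v ^ 2] only, so a small [v]
    contradicts the definition of [S]. *)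
Lemma one_sided_decay (mu : Z -> C) (M : R) :
  (forall p B, (forall x, Cmod (eval p x) <= B) -> Cmod (moment mu p) <= M * B) ->
  tends (fun n => mu (Z.of_nat n)) 0 ->
  tends (fun n => mu (- Z.of_nat n)%Z) 0.
Proof.
intros HM Hplus delta Hdelta.
(* otherwise the moments are at least delta at infinitely many negative frequencies *)
apply NNPP. intros Hno.
assert (Hbig : forall N, exists n, (N <= n)%nat /\ delta <= Cmod (mu (- Z.of_nat n)%Z)).
{ intros N. apply NNPP. intros Hn. apply Hno. exists N. intros n HNn.
  replace (mu (- Z.of_nat n)%Z - 0)%C with (mu (- Z.of_nat n)%Z) by ring.
  apply Rnot_le_lt. intros Hle. apply Hn. now exists n. }
set (E := fun x : R => exists p, (forall t, Cmod (eval p t) <= 1) /\ x = Re (moment mu p)).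
assert (HE : bound E).
{ exists (M * 1). intros x (p & Hp & ->).
  apply Rle_trans with (Cmod (moment mu p)); [apply Re_le_Cmod | now apply HM]. }
destruct (completeness E HE) as [S [HS1 HS2]].
{ exists 0, nil. split; [ | reflexivity]. intros t. simpl. rewrite Cmod_0. lra. }
assert (HS0 : 0 <= S).
{ apply HS1. exists nil. split; [ | reflexivity]. intros t. simpl. rewrite Cmod_0. lra. }
(* small enough for the gain v * delta / 2 to beat the loss (2 * S + 1) * v ^ 2 *)
set (v := Rmin (/ 2) (delta / (4 * (2 * S + 1)))).
assert (Hv0 : 0 < v).
{ apply Rmin_glb_lt; [lra | apply Rdiv_lt_0_compat; lra]. }
assert (Hv1 : v <= / 2) by apply Rmin_l.
assert (Hv2 : (2 * S + 1) * v <= delta / 4).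
{ apply Rle_trans with ((2 * S + 1) * (delta / (4 * (2 * S + 1)))).
  - apply Rmult_le_compat_l; [lra | apply Rmin_r].
  - right. field. lra. }
assert (Hnear : exists p, (forall t, Cmod (eval p t) <= 1) /\ S - v ^ 2 < Re (moment mu p)).
{ apply NNPP. intros Hn.
  assert (S <= S - v ^ 2); [ | nra].
  apply HS2. intros x (p & Hp & ->). apply Rnot_lt_le. intros Hlt. apply Hn. now exists p. }
destruct Hnear as (p & Hp1 & Hp).
destruct (moment_shift_tends_0 mu (polymul p p) Hplus (delta / 2)) as [N HN]; [lra | ].
destruct (Hbig N) as (n & Hn & Hmu).
specialize (HN n Hn).
destruct (unimodular_phase (mu (- Z.of_nat n)%Z)) as (w & Hw & Hphase).
set (q := p ++ ((- Z.of_nat n)%Z, (v * w)%C)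
            :: monomul (Z.of_nat n) (- (v * Cconj w))%C (polymul p p)).
assert (Hq : forall t, Cmod (eval q t) <= 1 + 2 * v ^ 2).
{ intros t. unfold q. rewrite eval_app, eval_cons, eval_monomul, eval_polymul.
  set (s := (v * Cconj w * expk (Z.of_nat n) t)%C).
  assert (Hs : Cmod s = v).
  { unfold s. rewrite !Cmod_mult, Cmod_R, Cmod_conj, Hw, Cmod_expk, Rabs_pos_eq by lra. ring. }
  replace (v * w * expk (- Z.of_nat n) t +
     - (v * Cconj w) * expk (Z.of_nat n) t * (eval p t * eval p t))%C
    with (Cconj s - s * (eval p t * eval p t))%C.
  - rewrite <- Hs. apply disc_perturbation; [apply Hp1 | lra].
  - unfold s. rewrite !Cmult_conj, Cconj_conj, expk_opp.
    replace (Cconj v) with (RtoC v); [ring | ].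
    unfold Cconj, RtoC; simpl. f_equal. ring. }
(* rescaled into the unit ball, q competes in the supremum S *)
set (c := / (1 + 2 * v ^ 2)).
assert (Hc : 0 < 1 + 2 * v ^ 2) by nra.
assert (HqS : Re (moment mu q) <= S * (1 + 2 * v ^ 2)).
{ assert (H1 : c * Re (moment mu q) <= S).
  { apply HS1. exists (monomul 0 c q). split.
    - intros t. rewrite eval_monomul, expk_0, Cmult_1_r, Cmod_mult, Cmod_R.
      unfold c. rewrite Rabs_pos_eq by (left; now apply Rinv_0_lt_compat).
      apply Rmult_le_reg_l with (1 + 2 * v ^ 2); [assumption | ].
      rewrite <- Rmult_assoc, Rinv_r, Rmult_1_l, Rmult_1_r by lra. apply Hq.
    - rewrite moment_monomul_0. now rewrite re_scal_l. }
  apply Rmult_le_reg_l with c; [now apply Rinv_0_lt_compat | ].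
  replace (c * (S * (1 + 2 * v ^ 2))) with S; [exact H1 | ].
  unfold c. field. lra. }
assert (Hgain : S - v ^ 2 + v * delta - v * (delta / 2) <= Re (moment mu q)).
{ unfold q. rewrite moment_app, moment_cons, moment_shift.
  set (X := moment (fun l => mu (Z.of_nat n + l)%Z) (polymul p p)) in *.
  replace (v * w * mu (- Z.of_nat n)%Z)%C with (v * (w * mu (- Z.of_nat n)%Z))%C by ring.
  rewrite Hphase, !re_plus, re_scal_l, re_RtoC.
  assert (HX : - (v * (delta / 2)) <= Re (- (v * Cconj w) * X)%C).
  { replace (- (v * Cconj w) * X)%C with (- (v * Cconj w * X))%C by ring.
    rewrite re_opp. apply Ropp_le_contravar.
    eapply Rle_trans; [apply Re_le_Cmod | ].
    rewrite !Cmod_mult, Cmod_R, Cmod_conj, Hw, Rmult_1_r, (Rabs_pos_eq v) by lra.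
    apply Rmult_le_compat_l; [lra | ].
    replace X with (X - 0)%C by ring. lra. }
  nra. }
nra.
Qed.

(** * Calculus of complex-valued functions of a real variable *)

(** Continuity, derivative and integral are taken coordinatewise, which reduces
    the calculus below to that of real functions. *)
Definition Ccont (f : R -> C) (x : R) : Prop :=
  continuous (fun t => fst (f t)) x /\ continuous (fun t => snd (f t)) x.

Definition Cderiv (f : R -> C) (x : R) (l : C) : Prop :=
  is_derive (fun t => fst (f t)) x (fst l) /\ is_derive (fun t => snd (f t)) x (snd l).

Definition CInt (f : R -> C) (a b : R) : C :=
  (RInt (fun t => fst (f t)) a b, RInt (fun t => snd (f t)) a b).

Lemma Ccont_const c x : Ccont (fun _ => c) x.
Proof. split; apply continuous_const. Qed.

Lemma Ccont_plus f g x : Ccont f x -> Ccont g x -> Ccont (fun t => f t + g t)%C x.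
Proof.
intros [H1 H2] [H3 H4]; split; simpl.
- now apply (continuous_plus (K := R_AbsRing) (V := R_NormedModule)).
- now apply (continuous_plus (K := R_AbsRing) (V := R_NormedModule)).
Qed.

Lemma Ccont_opp f x : Ccont f x -> Ccont (fun t => - f t)%C x.
Proof.
intros [H1 H2]; split; simpl.
- now apply (continuous_opp (K := R_AbsRing) (V := R_NormedModule)).
- now apply (continuous_opp (K := R_AbsRing) (V := R_NormedModule)).
Qed.

Lemma Ccont_mult f g x : Ccont f x -> Ccont g x -> Ccont (fun t => f t * g t)%C x.
Proof.
intros [H1 H2] [H3 H4]; split; simpl.
- apply (continuous_minus (K := R_AbsRing) (V := R_NormedModule));
    now apply (continuous_mult (K := R_AbsRing)).
- apply (continuous_plus (K := R_AbsRing) (V := R_NormedModule));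
    now apply (continuous_mult (K := R_AbsRing)).
Qed.

Lemma Ccont_real (f : R -> R) x : continuous f x -> Ccont (fun t => RtoC (f t)) x.
Proof. intros H; split; [exact H | apply continuous_const]. Qed.

Lemma Ccont_ext f g x : (forall t, f t = g t) -> Ccont f x -> Ccont g x.
Proof.
intros E [H1 H2]; split.
- apply (continuous_ext (fun t => fst (f t))); [intros t; now rewrite E | exact H1].
- apply (continuous_ext (fun t => snd (f t))); [intros t; now rewrite E | exact H2].
Qed.

Lemma Ccont_normsq f x :
  Ccont f x -> continuous (fun t => fst (f t) ^ 2 + snd (f t) ^ 2) x.
Proof.
intros [H1 H2].
apply (continuous_ext (fun t => fst (f t) * fst (f t) + snd (f t) * snd (f t))).
- intros t. simpl. now rewrite !Rmult_1_r.
- apply (continuous_plus (K := R_AbsRing) (V := R_NormedModule)).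
  + now apply (continuous_mult (K := R_AbsRing) (fun t => fst (f t)) (fun t => fst (f t))).
  + now apply (continuous_mult (K := R_AbsRing) (fun t => snd (f t)) (fun t => snd (f t))).
Qed.

Lemma Ccont_inv (f : R -> C) x : f x <> 0 -> Ccont f x -> Ccont (fun t => / f t)%C x.
Proof.
intros Hf Hc0. assert (H0 := Ccont_normsq f x Hc0). destruct Hc0 as [H1 H2].
assert (Hn : fst (f x) ^ 2 + snd (f x) ^ 2 <> 0).
{ rewrite <- Cmod_sqr. apply Rgt_not_eq, pow_lt. now apply Cmod_gt_0. }
assert (Hc : continuous (fun t => / (fst (f t) ^ 2 + snd (f t) ^ 2)) x).
{ now apply continuous_Rinv_comp. }
split.
- now apply (continuous_mult (K := R_AbsRing) (fun t => fst (f t))).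
- apply (continuous_mult (K := R_AbsRing) (fun t => - snd (f t))); [ | exact Hc].
  now apply (continuous_opp (K := R_AbsRing) (V := R_NormedModule)).
Qed.

Lemma Ccont_Cmod f x : Ccont f x -> continuous (fun t => Cmod (f t)) x.
Proof.
intros H. apply (continuous_comp (fun t => fst (f t) ^ 2 + snd (f t) ^ 2) sqrt).
- now apply Ccont_normsq.
- apply continuous_sqrt.
Qed.

Lemma Cderiv_cont f x l : Cderiv f x l -> Ccont f x.
Proof.
intros [H1 H2]; split.
- apply (ex_derive_continuous (K := R_AbsRing) (V := R_NormedModule)). now exists (fst l).
- apply (ex_derive_continuous (K := R_AbsRing) (V := R_NormedModule)). now exists (snd l).
Qed.

Lemma is_derive_eq (f : R -> R) x l l' : l = l' -> is_derive f x l -> is_derive f x l'.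
Proof. now intros <-. Qed.

Lemma Cderiv_eq f x l l' : Cderiv f x l -> l = l' -> Cderiv f x l'.
Proof. now intros H <-. Qed.

Lemma Cderiv_ext f g x l : (forall t, f t = g t) -> Cderiv f x l -> Cderiv g x l.
Proof.
intros E [H1 H2]; split.
- apply (is_derive_ext (fun t => fst (f t))); [intros t; now rewrite E | exact H1].
- apply (is_derive_ext (fun t => snd (f t))); [intros t; now rewrite E | exact H2].
Qed.

Lemma Cderiv_const c x : Cderiv (fun _ => c) x 0.
Proof. split; apply (is_derive_const (K := R_AbsRing) (V := R_NormedModule)). Qed.

Lemma Cderiv_plus f g x l m :
  Cderiv f x l -> Cderiv g x m -> Cderiv (fun t => f t + g t)%C x (l + m)%C.
Proof.
intros [H1 H2] [H3 H4]; split.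
- now apply (is_derive_plus (K := R_AbsRing) (V := R_NormedModule)
    (fun t => fst (f t)) (fun t => fst (g t))).
- now apply (is_derive_plus (K := R_AbsRing) (V := R_NormedModule)
    (fun t => snd (f t)) (fun t => snd (g t))).
Qed.

Lemma Cderiv_mult f g x l m :
  Cderiv f x l -> Cderiv g x m ->
  Cderiv (fun t => f t * g t)%C x (l * g x + f x * m)%C.
Proof.
intros [H1 H2] [H3 H4].
assert (P : forall (u v : R -> R) (p q : R), is_derive u x p -> is_derive v x q ->
  is_derive (fun t => u t * v t) x (p * v x + u x * q)).
{ intros u v p q Hu Hv. apply (is_derive_mult u v x p q Hu Hv). intros; apply Rmult_comm. }
split; simpl.
- generalize (is_derive_minus (V := R_NormedModule) _ _ _ _ _
    (P _ _ _ _ H1 H3) (P _ _ _ _ H2 H4)).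
  apply is_derive_eq. unfold minus, plus, opp; simpl. ring.
- generalize (is_derive_plus (V := R_NormedModule) _ _ _ _ _
    (P _ _ _ _ H1 H4) (P _ _ _ _ H2 H3)).
  apply is_derive_eq. unfold plus; simpl. ring.
Qed.

Lemma Cderiv_expi c x : Cderiv (fun t => expi (c * t)) x (Ci * c * expi (c * x))%C.
Proof.
split; simpl; auto_derive; auto; ring.
Qed.

Lemma Cderiv_id x : Cderiv (fun t => RtoC t) x 1.
Proof. split; simpl; auto_derive; auto. Qed.

Lemma Ccont_expk k x : Ccont (expk k) x.
Proof. eapply Cderiv_cont, (Cderiv_expi (IZR k)). Qed.

Lemma Ccont_expi x : Ccont expi x.
Proof.
apply (Ccont_ext (expk 1)); [ | apply Ccont_expk].
intros t. unfold expk. now rewrite Rmult_1_l.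
Qed.

Section Integral.

Context (a b : R) (Hab : a <= b).

Definition Ccont_on (f : R -> C) : Prop := forall t, a <= t <= b -> Ccont f t.

Lemma Ccont_on_ex f :
  Ccont_on f -> ex_RInt (fun t => fst (f t)) a b /\ ex_RInt (fun t => snd (f t)) a b.
Proof.
intros Hf. split; apply (ex_RInt_continuous (V := R_CompleteNormedModule));
  rewrite Rmin_left, Rmax_right by lra; intros t Ht; now apply Hf.
Qed.

Lemma CInt_ext f g : (forall t, a <= t <= b -> f t = g t) -> CInt f a b = CInt g a b.
Proof.
intros E. unfold CInt. f_equal; apply RInt_ext; rewrite Rmin_left, Rmax_right by lra;
  intros t Ht; rewrite E; auto; lra.
Qed.

Lemma CInt_plus f g :
  Ccont_on f -> Ccont_on g -> CInt (fun t => f t + g t)%C a b = (CInt f a b + CInt g a b)%C.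
Proof.
intros Hf Hg. apply Ccont_on_ex in Hf. apply Ccont_on_ex in Hg.
unfold CInt, Cplus; simpl. f_equal;
  now apply (RInt_plus (V := R_CompleteNormedModule)).
Qed.

Lemma CInt_scal c f : Ccont_on f -> CInt (fun t => c * f t)%C a b = (c * CInt f a b)%C.
Proof.
intros Hf. apply Ccont_on_ex in Hf. destruct Hf as [H1 H2].
unfold CInt, Cmult; simpl.
assert (S : forall k (g : R -> R), ex_RInt g a b ->
  is_RInt (fun t => k * g t) a b (k * RInt g a b)).
{ intros k g Hg. apply (is_RInt_scal (V := R_NormedModule)).
  now apply (RInt_correct (V := R_CompleteNormedModule)). }
f_equal; apply is_RInt_unique.
- apply (is_RInt_minus (V := R_NormedModule)); now apply S.
- apply (is_RInt_plus (V := R_NormedModule)); now apply S.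
Qed.

Lemma CInt_opp f : Ccont_on f -> CInt (fun t => - f t)%C a b = (- CInt f a b)%C.
Proof.
intros Hf. replace (- CInt f a b)%C with (RtoC (-1) * CInt f a b)%C.
- rewrite <- CInt_scal by assumption. apply CInt_ext. intros t _. ring.
- ring.
Qed.

Lemma CInt_FTC F f :
  (forall t, a <= t <= b -> Cderiv F t (f t)) -> Ccont_on f ->
  CInt f a b = (F b - F a)%C.
Proof.
intros HF Hf. unfold CInt, Cminus, Cplus, Copp. simpl.
f_equal; apply is_RInt_unique.
- apply (is_RInt_derive (V := R_CompleteNormedModule) (fun t => fst (F t)));
    rewrite Rmin_left, Rmax_right by lra; intros t Ht; [apply (HF t Ht) | apply (Hf t Ht)].
- apply (is_RInt_derive (V := R_CompleteNormedModule) (fun t => snd (F t)));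
    rewrite Rmin_left, Rmax_right by lra; intros t Ht; [apply (HF t Ht) | apply (Hf t Ht)].
Qed.

(** The factor 2 comes from estimating real and imaginary parts separately. *)
Lemma CInt_Cmod_le f g :
  Ccont_on f -> ex_RInt g a b -> (forall t, a <= t <= b -> Cmod (f t) <= g t) ->
  Cmod (CInt f a b) <= 2 * RInt g a b.
Proof.
intros Hf Hg Hle. destruct (Ccont_on_ex f Hf) as [H1 H2].
assert (P : forall (h : R -> R), ex_RInt h a b ->
  (forall t, a <= t <= b -> Rabs (h t) <= Cmod (f t)) -> Rabs (RInt h a b) <= RInt g a b).
{ intros h Hh Hht. apply (norm_RInt_le (V := R_NormedModule) h g a b); [exact Hab | | | ].
  - intros t Ht. apply Rle_trans with (Cmod (f t)); [now apply Hht | now apply Hle].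
  - now apply (RInt_correct (V := R_CompleteNormedModule)).
  - now apply (RInt_correct (V := R_CompleteNormedModule)). }
assert (P1 := P _ H1 (fun t _ => Rle_trans _ _ _ (Rmax_l _ _) (Rmax_Cmod (f t)))).
assert (P2 := P _ H2 (fun t _ => Rle_trans _ _ _ (Rmax_r _ _) (Rmax_Cmod (f t)))).
unfold CInt.
replace (RInt (fun t => fst (f t)) a b, RInt (fun t => snd (f t)) a b) with
  (RtoC (RInt (fun t => fst (f t)) a b) + Ci * RtoC (RInt (fun t => snd (f t)) a b))%C.
- eapply Rle_trans; [apply Cmod_triangle | ].
  rewrite Cmod_mult, Cmod_Ci, !Cmod_R. lra.
- unfold Cplus, Cmult, Ci, RtoC; simpl. f_equal; ring.
Qed.

Lemma CInt_Cmod_le_const f B :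
  Ccont_on f -> (forall t, a <= t <= b -> Cmod (f t) <= B) ->
  Cmod (CInt f a b) <= 2 * ((b - a) * B).
Proof.
intros Hf HB.
replace ((b - a) * B) with (RInt (fun _ => B) a b).
- apply CInt_Cmod_le; [assumption | | assumption].
  apply (ex_RInt_const (V := R_NormedModule)).
- rewrite RInt_const. reflexivity.
Qed.

Lemma Ccont_Csum (s : nat -> R -> C) n t :
  (forall k, Ccont (s k) t) -> Ccont (fun x => Csum (fun k => s k x) n) t.
Proof.
intros Hs. induction n as [|n IH].
- apply (Ccont_ext (s 0%nat)); [intros x; now rewrite Csum_0 | apply Hs].
- apply (Ccont_ext (fun x => Csum (fun k => s k x) n + s (S n) x)%C).
  + intros x; now rewrite Csum_S.
  + apply Ccont_plus; [exact IH | apply Hs].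
Qed.

Lemma CInt_Csum (s : nat -> R -> C) n :
  (forall k, Ccont_on (s k)) ->
  CInt (fun t => Csum (fun k => s k t) n) a b = Csum (fun k => CInt (s k) a b) n.
Proof.
intros Hs. induction n as [|n IH].
- rewrite Csum_0. apply CInt_ext. intros t _. now rewrite Csum_0.
- rewrite Csum_S, <- IH, <- CInt_plus.
  + apply CInt_ext. intros t _. now rewrite Csum_S.
  + intros t Ht. apply Ccont_Csum. intros k. now apply Hs.
  + apply Hs.
Qed.

Lemma CInt_sums (s : nat -> R -> C) (g : R -> C) y Y :
  nonneg_series y Y -> (forall k, Ccont_on (s k)) -> Ccont_on g ->
  (forall k t, a <= t <= b -> Cmod (s k t) <= y k) ->
  (forall t, a <= t <= b -> sums (fun k => s k t) (g t)) ->
  sums (fun k => CInt (s k) a b) (CInt g a b).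
Proof.
intros HY Hs Hg Hsy Hsum eps Heps.
destruct (nonneg_series_tail y Y HY (eps / (2 * (b - a) + 1))) as [N HN].
{ apply Rdiv_lt_0_compat; lra. }
exists N. intros n Hn. rewrite <- CInt_Csum by assumption.
rewrite Cmod_sub_sym.
assert (Hc : Ccont_on (fun t => Csum (fun k => s k t) n)).
{ intros t Ht. apply Ccont_Csum. intros k. now apply Hs. }
unfold Cminus. rewrite <- CInt_opp by assumption. rewrite <- CInt_plus.
- apply Rle_lt_trans with (2 * ((b - a) * (Y - sum_n y n))).
  + apply CInt_Cmod_le_const.
    * intros t Ht. apply Ccont_plus; [now apply Hg | apply Ccont_opp; now apply Hc].
    * intros t Ht. apply (dominated_tail (fun k => s k t) (g t) y Y n HY).
      -- intros k. now apply Hsy.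
      -- now apply Hsum.
  + specialize (HN n Hn). generalize (nonneg_series_sum_le y Y n HY). intros H0.
    apply Rle_lt_trans with ((2 * (b - a)) * (eps / (2 * (b - a) + 1))); [nra | ].
    apply Rlt_le_trans with ((2 * (b - a) + 1) * (eps / (2 * (b - a) + 1))).
    * apply Rmult_lt_compat_r; [apply Rdiv_lt_0_compat | ]; lra.
    * right. field. lra.
- assumption.
- intros t Ht. now apply Ccont_opp, Hc.
Qed.

End Integral.

Lemma CInt_Chasles f a b c :
  a <= b <= c -> Ccont_on a c f -> CInt f a c = (CInt f a b + CInt f b c)%C.
Proof.
intros H Hf.
destruct (Ccont_on_ex a b ltac:(lra) f) as [H1 H2]; [intros t Ht; apply Hf; lra | ].
destruct (Ccont_on_ex b c ltac:(lra) f) as [H3 H4]; [intros t Ht; apply Hf; lra | ].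
unfold CInt, Cplus; simpl. f_equal; symmetry;
  now apply (RInt_Chasles (V := R_CompleteNormedModule)).
Qed.

(** The usual three-epsilon argument, run on one real coordinate [pr] at a time. *)
Lemma dominated_sums_cont (s : nat -> R -> C) (g : R -> C) y Y x :
  nonneg_series y Y -> (forall k t, Ccont (s k) t) ->
  (forall k t, Cmod (s k t) <= y k) -> (forall t, sums (fun k => s k t) (g t)) ->
  Ccont g x.
Proof.
intros HY Hs Hsy Hsum.
assert (P : forall (pr : C -> R), (forall z w, Rabs (pr z - pr w) <= Cmod (z - w)%C) ->
  (forall n, continuous (fun t => pr (Csum (fun k => s k t) n)) x) ->
  continuous (fun t => pr (g t)) x).
{ intros pr Hpr Hc. intros Q [eps HQ].
  destruct (nonneg_series_tail y Y HY (eps / 3)) as [N HN].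
  { generalize (cond_pos eps). lra. }
  specialize (HN N (Nat.le_refl _)).
  assert (He : 0 < eps / 3) by (generalize (cond_pos eps); lra).
  assert (Hloc := Hc N (ball (pr (Csum (fun k => s k x) N)) (mkposreal _ He))
    (locally_ball _ (mkposreal _ He))).
  unfold filtermap in *. revert Hloc. apply filter_imp. intros t Ht. apply HQ.
  change (Rabs (pr (Csum (fun k => s k t) N) - pr (Csum (fun k => s k x) N)) < eps / 3) in Ht.
  change (Rabs (pr (g t) - pr (g x)) < eps).
  assert (D : forall t, Rabs (pr (g t) - pr (Csum (fun k => s k t) N)) < eps / 3).
  { intros r. eapply Rle_lt_trans; [apply Hpr | ].
    eapply Rle_lt_trans; [ | exact HN].
    apply (dominated_tail (fun k => s k r) (g r) y Y N HY (fun k => Hsy k r) (Hsum r)). }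
  generalize (D t) (D x). intros D1 D2.
  apply Rabs_def2 in Ht. apply Rabs_def2 in D1. apply Rabs_def2 in D2.
  apply Rabs_def1; lra. }
split.
- apply P; [intros z w; exact (Rle_trans _ _ _ (Rmax_l _ _) (Rmax_Cmod (z - w)%C)) | ].
  intros n. apply (Ccont_Csum s n x (fun k => Hs k x)).
- apply P; [intros z w; exact (Rle_trans _ _ _ (Rmax_r _ _) (Rmax_Cmod (z - w)%C)) | ].
  intros n. apply (Ccont_Csum s n x (fun k => Hs k x)).
Qed.

(** * Fourier moments of a triangle *)

(** A triangle of slope 1 and height [h]; it is negative outside
    [[t - h, t + h]] and only ever integrated over that interval. *)
Definition hat (t h x : R) : R := h - Rabs (x - t).

Definition hat_moment (t h : R) (k : Z) : C :=
  CInt (fun x => hat t h x * expk k x)%C (t - h) (t + h).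

Definition second_diff (f : R -> C) (t h : R) : C :=
  (f (t + h)%R - 2 * f t + f (t - h)%R)%C.

Lemma Ccont_hat t h x : Ccont (fun y => RtoC (hat t h y)) x.
Proof.
apply Ccont_real. unfold hat.
apply (continuous_minus (K := R_AbsRing) (V := R_NormedModule)); [apply continuous_const | ].
apply (continuous_comp (fun y => y - t) Rabs); [ | apply continuous_Rabs].
apply (continuous_minus (K := R_AbsRing) (V := R_NormedModule));
  [apply continuous_id | apply continuous_const].
Qed.

Lemma hat_bounds t h x : t - h <= x <= t + h -> 0 <= hat t h x <= h.
Proof.
intros Hx. unfold hat. generalize (Rabs_pos (x - t)).
assert (Rabs (x - t) <= h) by (apply Rabs_le; lra). lra.
Qed.

Lemma hat_moment_0 t h : 0 <= h -> hat_moment t h 0 = RtoC (h ^ 2).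
Proof.
intros Hh. unfold hat_moment.
rewrite (CInt_Chasles _ (t - h) t (t + h)) by
  solve [lra | intros x _; apply Ccont_mult; [apply Ccont_hat | apply Ccont_expk]].
rewrite (CInt_ext (t - h) t ltac:(lra) _ (fun x => RtoC (h - t) + RtoC x)%C).
2: { intros x Hx. rewrite expk_0. unfold hat. rewrite Rabs_left1 by lra.
     rewrite Cmult_1_r, <- RtoC_plus. f_equal. ring. }
rewrite (CInt_ext t (t + h) ltac:(lra) _ (fun x => RtoC (h + t) + RtoC (-1) * RtoC x)%C).
2: { intros x Hx. rewrite expk_0. unfold hat. rewrite Rabs_pos_eq by lra.
     rewrite Cmult_1_r, <- RtoC_mult, <- RtoC_plus. f_equal. ring. }
assert (D : forall p q x, Cderiv (fun x => RtoC p * RtoC x + RtoC (q / 2) * (RtoC x * RtoC x))%C x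
   (RtoC p + RtoC q * RtoC x)%C).
{ intros p q x. eapply Cderiv_eq.
  - apply Cderiv_plus.
    + apply Cderiv_mult; [apply Cderiv_const | apply Cderiv_id].
    + apply Cderiv_mult; [apply Cderiv_const | ].
      apply Cderiv_mult; apply Cderiv_id.
  - rewrite (RtoC_div q 2) by lra. field. }
assert (Cn : forall p q x, Ccont (fun x => RtoC p + RtoC q * RtoC x)%C x).
{ intros p q x. apply Ccont_plus; [apply Ccont_const | ].
  apply Ccont_mult; [apply Ccont_const | eapply Cderiv_cont, Cderiv_id]. }
rewrite (CInt_FTC (t - h) t ltac:(lra)
  (fun x => RtoC (h - t) * RtoC x + RtoC (1 / 2) * (RtoC x * RtoC x))%C).
2: { intros x _. eapply Cderiv_eq; [apply D | ring]. }
2: { intros x _. eapply Ccont_ext; [ | apply (Cn (h - t) 1)]. intros y. simpl. ring. }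
rewrite (CInt_FTC t (t + h) ltac:(lra)
  (fun x => RtoC (h + t) * RtoC x + RtoC (-1 / 2) * (RtoC x * RtoC x))%C).
2: { intros x _. apply D. }
2: { intros x _. apply Cn. }
rewrite <- !RtoC_mult, <- !RtoC_plus, <- !RtoC_minus, <- !RtoC_plus. f_equal. field.
Qed.

(** Integrating by parts twice turns the triangle into the second difference
    of its three corner point masses. *)
Lemma hat_moment_second_diff t h k :
  0 <= h -> (- RtoC (IZR k ^ 2) * hat_moment t h k)%C = second_diff (expk k) t h.
Proof.
intros Hh.
set (w := (Ci * IZR k)%C).
assert (Hw : (- RtoC (IZR k ^ 2))%C = (w * w)%C).
{ unfold w, Ci, Cmult, Copp, RtoC; simpl. f_equal; ring. }
assert (De : forall x, Cderiv (expk k) x (w * expk k x)%C).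
{ intros x. apply (Cderiv_expi (IZR k)). }
assert (Clin : forall p q x, Ccont (fun x => (RtoC p + RtoC q * RtoC x) * expk k x)%C x).
{ intros p q x. apply Ccont_mult; [ | apply Ccont_expk].
  apply Ccont_plus; [apply Ccont_const | ].
  apply Ccont_mult; [apply Ccont_const | eapply Cderiv_cont, Cderiv_id]. }
assert (P : forall u v p q, u <= v ->
  (w * w * CInt (fun x => (RtoC p + RtoC q * RtoC x) * expk k x) u v)%C =
  ((w * (p + q * v) - q) * expk k v - (w * (p + q * u) - q) * expk k u)%C).
{ intros u v p q Huv.
  rewrite <- (CInt_scal u v Huv) by (intros x _; apply Clin).
  rewrite (CInt_FTC u v Huv (fun x => (w * (RtoC p + RtoC q * RtoC x) + - RtoC q) * expk k x)%C).
  - unfold Cminus. ring.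
  - intros x _. eapply Cderiv_eq.
    + apply Cderiv_mult; [ | apply De].
      apply Cderiv_plus; [ | apply Cderiv_const].
      apply Cderiv_mult; [apply Cderiv_const | ].
      apply Cderiv_plus; [apply Cderiv_const | ].
      apply Cderiv_mult; [apply Cderiv_const | apply Cderiv_id].
    + simpl. ring.
  - intros x _. apply Ccont_mult; [apply Ccont_const | apply Clin]. }
unfold hat_moment.
rewrite (CInt_Chasles _ (t - h) t (t + h)) by
  solve [lra | intros x _; apply Ccont_mult; [apply Ccont_hat | apply Ccont_expk]].
rewrite (CInt_ext (t - h) t ltac:(lra) _ (fun x => (RtoC (h - t) + RtoC 1 * RtoC x) * expk k x)%C).
2: { intros x Hx. unfold hat. rewrite Rabs_left1 by lra. f_equal.
     rewrite <- RtoC_mult, <- RtoC_plus. f_equal. ring. }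
rewrite (CInt_ext t (t + h) ltac:(lra) _ (fun x => (RtoC (h + t) + RtoC (-1) * RtoC x) * expk k x)%C).
2: { intros x Hx. unfold hat. rewrite Rabs_pos_eq by lra. f_equal.
     rewrite <- RtoC_mult, <- RtoC_plus. f_equal. ring. }
rewrite Hw, Cmult_plus_distr_l, !P by lra.
unfold second_diff.
rewrite !RtoC_plus, !RtoC_minus. ring.
Qed.

Lemma Cmod_second_diff_expk k t h : Cmod (second_diff (expk k) t h) <= 4.
Proof.
unfold second_diff, Cminus.
generalize (Cmod_triangle (expk k (t + h)%R + - (2 * expk k t))%C (expk k (t - h))).
generalize (Cmod_triangle (expk k (t + h))%C (- (2 * expk k t))%C).
rewrite Cmod_opp, Cmod_mult, Cmod_R, !Cmod_expk, Rabs_pos_eq by lra. lra.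
Qed.

Lemma hat_moment_bound t h : 0 <= h ->
  exists K, 0 <= K /\ forall k, Cmod (hat_moment t h k) <= K * invsq (Z.abs_nat k).
Proof.
intros Hh. (* 16 = 4 * 4: the second difference is at most 4, and (k + 1) ^ 2 <= 4 * k ^ 2 *)
exists (16 + h ^ 2). split; [nra | ]. intros k. unfold invsq.
destruct (Z.eq_dec k 0) as [->|Hk].
- rewrite hat_moment_0 by assumption. rewrite Cmod_R, Rabs_pos_eq by nra. simpl. nra.
- set (x := INR (Z.abs_nat k)).
  assert (Hx : 1 <= x).
  { unfold x. change 1 with (INR 1). apply le_INR. lia. }
  assert (E : x ^ 2 * Cmod (hat_moment t h k) <= 4).
  { generalize (Cmod_second_diff_expk k t h).
    rewrite <- hat_moment_second_diff by assumption.
    rewrite Cmod_mult, Cmod_opp, Cmod_R, Rabs_pos_eq by apply pow2_ge_0.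
    unfold x. rewrite INR_IZR_INZ, Zabs2Nat.id_abs, abs_IZR.
    rewrite <- (pow2_abs (IZR k)). lra. }
  apply Rmult_le_reg_r with ((x + 1) ^ 2); [nra | ].
  rewrite Rmult_assoc, Rinv_l, Rmult_1_r by nra.
  generalize (Cmod_ge_0 (hat_moment t h k)). intros H0.
  assert ((x + 1) ^ 2 <= 4 * x ^ 2) by nra. nra.
Qed.

(** * Vanishing of right limits on the arc *)

(** A series over [Z] is summed symmetrically, as the series of these terms. *)
Definition two_sided (g : Z -> C) (k : nat) : C :=
  match k with
  | O => g 0%Z
  | S _ => (g (Z.of_nat k) + g (- Z.of_nat k)%Z)%C
  end.

(** The filling value to the left of [a 0] does not survive in right limits,
    since every fixed index [n] satisfies [0 <= n + s] for large [s]. *)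
Definition recentred (a : nat -> C) (s : nat) (n : Z) : C :=
  if Z.leb 0 (n + Z.of_nat s) then a (Z.to_nat (n + Z.of_nat s)) else 0.

(** Once [s <= n], the window of radius [n] around the index [s] covers all of
    [0, ..., s + n]. *)
Lemma sum_recentred (a : nat -> C) (c : Z -> C) s n : (s <= n)%nat ->
  Csum (two_sided (fun l => recentred a s l * c l)%C) n =
  Csum (fun m => a m * c (Z.of_nat m - Z.of_nat s)%Z)%C (s + n).
Proof.
set (g := fun m => (a m * c (Z.of_nat m - Z.of_nat s)%Z)%C).
set (w := two_sided (fun l => recentred a s l * c l)%C).
set (below := fun N => match N with O => RtoC 0 | S N' => Csum g N' end).
assert (Hbelow : forall N, below (S N) = (below N + g N)%C).
{ intros [|N]; simpl; [rewrite Csum_0; ring | now rewrite Csum_S]. }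
assert (Hpos : forall k, (recentred a s (Z.of_nat k) * c (Z.of_nat k))%C = g (s + k)%nat).
{ intros k. unfold recentred, g. destruct (Z.leb_spec 0 (Z.of_nat k + Z.of_nat s)); [ | lia].
  f_equal; f_equal; lia. }
assert (Hneg : forall k, (k <= s)%nat ->
  (recentred a s (- Z.of_nat k) * c (- Z.of_nat k)%Z)%C = g (s - k)%nat).
{ intros k Hk. unfold recentred, g. destruct (Z.leb_spec 0 (- Z.of_nat k + Z.of_nat s)); [ | lia].
  f_equal; f_equal; lia. }
assert (Hfar : forall k, (s < k)%nat ->
  (recentred a s (- Z.of_nat k) * c (- Z.of_nat k)%Z)%C = 0).
{ intros k Hk. unfold recentred. destruct (Z.leb_spec 0 (- Z.of_nat k + Z.of_nat s)); [lia | ring]. }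
(* as long as the window stays inside, what it misses on the left is [below] *)
assert (H1 : forall q, (q <= s)%nat -> (Csum w q + below (s - q)%nat)%C = Csum g (s + q)).
{ intros q. induction q as [|k IH]; intros Hk.
  - rewrite Csum_0, Nat.add_0_r, Nat.sub_0_r.
    change (w 0%nat) with (recentred a s (Z.of_nat 0) * c (Z.of_nat 0))%C.
    rewrite Hpos, Nat.add_0_r. change (Csum g s) with (below (S s)). rewrite Hbelow. ring.
  - rewrite Csum_S, Nat.add_succ_r, Csum_S, <- IH by lia.
    replace (s - k)%nat with (S (s - S k)) by lia. rewrite Hbelow.
    change (w (S k)) with (recentred a s (Z.of_nat (S k)) * c (Z.of_nat (S k)) +
      recentred a s (- Z.of_nat (S k)) * c (- Z.of_nat (S k))%Z)%C.
    rewrite Hpos, Hneg, Nat.add_succ_r by lia. ring. }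
intros Hn. induction Hn as [|k Hk IH].
- rewrite <- H1 by lia. rewrite Nat.sub_diag. simpl. ring.
- rewrite Csum_S, Nat.add_succ_r, Csum_S, IH. f_equal.
  change (w (S k)) with (recentred a s (Z.of_nat (S k)) * c (Z.of_nat (S k)) +
      recentred a s (- Z.of_nat (S k)) * c (- Z.of_nat (S k))%Z)%C.
  rewrite Hpos, Hfar, Nat.add_succ_r by lia. ring.
Qed.

Lemma sums_recentred a c s l :
  sums (fun m => a m * c (Z.of_nat m - Z.of_nat s)%Z)%C l ->
  sums (two_sided (fun n => recentred a s n * c n)%C) l.
Proof.
intros H eps Heps. destruct (H eps Heps) as [N HN].
exists (N + s)%nat. intros n Hn. rewrite sum_recentred by lia. apply HN. lia.
Qed.

Lemma expi_pow (r x : R) n : ((r * expi x) ^ n)%C = (RtoC (r ^ n) * expk (Z.of_nat n) x)%C.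
Proof.
induction n as [|n IH].
- simpl. rewrite expk_0. ring.
- rewrite Cpow_S, IH. rewrite Nat2Z.inj_succ. unfold Z.succ. rewrite expk_plus.
  replace (expk 1 x) with (expi x) by (unfold expk; now rewrite Rmult_1_l).
  simpl (r ^ S n). rewrite RtoC_mult. ring.
Qed.

Lemma invsq_antitone m n : (m <= n)%nat -> invsq n <= invsq m.
Proof.
intros H. apply le_INR in H. generalize (pos_INR m). intros Hm. unfold invsq.
apply Rinv_le_contravar; [apply pow_lt; lra | ]. apply pow_incr. lra.
Qed.

Lemma invsq_pos n : 0 < invsq n.
Proof. apply Rinv_0_lt_compat, pow_lt. generalize (pos_INR n). lra. Qed.

Lemma invsq_shift m j n : (m <= n + j)%nat -> invsq n <= (INR j + 1) ^ 2 * invsq m.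
Proof.
intros H. apply le_INR in H. rewrite plus_INR in H.
generalize (pos_INR m) (pos_INR n) (pos_INR j). intros Hm Hn Hj. unfold invsq.
apply Rmult_le_reg_l with ((INR n + 1) ^ 2); [apply pow_lt; lra | ].
rewrite Rinv_r by (apply pow_nonzero; lra).
apply Rmult_le_reg_r with ((INR m + 1) ^ 2); [apply pow_lt; lra | ].
replace ((INR n + 1) ^ 2 * ((INR j + 1) ^ 2 * / (INR m + 1) ^ 2) * (INR m + 1) ^ 2)
  with (((INR n + 1) * (INR j + 1)) ^ 2) by (field; lra).
rewrite Rmult_1_l. apply pow_incr. nra.
Qed.

Definition radius (j : nat) : R := 1 - / (INR j + 2).

Lemma radius_bounds j : 0 < radius j < 1.
Proof.
unfold radius. generalize (pos_INR j). intros Hj.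
assert (0 < / (INR j + 2)) by (apply Rinv_0_lt_compat; lra).
assert (/ (INR j + 2) <= / 2) by (apply Rinv_le_contravar; lra). lra.
Qed.

Lemma radius_pow_tends_1 m : tends (fun j => RtoC (radius j ^ m)) 1.
Proof.
assert (H1 : tends (fun j => RtoC (radius j)) 1).
{ intros eps Heps.
  destruct (archimed_cor1 eps Heps) as (N & HN & HN0). exists N. intros n Hn.
  rewrite <- RtoC_minus, Cmod_R. unfold radius.
  apply le_INR in Hn. assert (0 < INR N) by now apply lt_0_INR.
  replace (1 - / (INR n + 2) - 1) with (- / (INR n + 2)) by ring.
  rewrite Rabs_Ropp, Rabs_pos_eq by (left; apply Rinv_0_lt_compat; lra).
  apply Rlt_trans with (2 := HN). apply Rinv_lt_contravar; nra. }
induction m as [|m IH].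
- exact (tends_const 1).
- intros eps Heps.
  destruct (H1 (eps / 2)) as [N1 HN1]; [lra | ].
  destruct (IH (eps / 2)) as [N2 HN2]; [lra | ].
  exists (max N1 N2). intros n Hn.
  specialize (HN1 n ltac:(lia)). specialize (HN2 n ltac:(lia)).
  rewrite <- RtoC_minus, Cmod_R in *. simpl.
  generalize (radius_bounds n). set (r := radius n) in *. intros Hr.
  replace (r * r ^ m - 1) with (r * (r ^ m - 1) + (r - 1)) by ring.
  eapply Rle_lt_trans; [apply Rabs_triang | ].
  rewrite Rabs_mult, (Rabs_pos_eq r) by lra.
  generalize (Rabs_pos (r ^ m - 1)). nra.
Qed.

Lemma tends_Cmod_le_approx u l B :
  tends u l ->
  (forall eps, 0 < eps -> exists N, forall n, (N <= n)%nat -> Cmod (u n) <= B + eps) ->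
  Cmod l <= B.
Proof.
intros H HB. apply Rnot_lt_le. intros Hlt.
destruct (H ((Cmod l - B) / 2)) as [N HN]; [lra | ].
destruct (HB ((Cmod l - B) / 2)) as [N' HN']; [lra | ].
specialize (HN (max N N') ltac:(lia)). specialize (HN' (max N N') ltac:(lia)).
rewrite Cmod_sub_sym in HN.
generalize (Cmod_sub_le l (u (max N N'))). lra.
Qed.

Section Twist.

Context (a : nat -> C) (A : R) (HA : forall n, Cmod (a n) <= A).
Lemma bound_nonneg : 0 <= A.
Proof. apply Rle_trans with (2 := HA 0), Cmod_ge_0. Qed.

Lemma right_limit_recentred b : right_limit a b ->
  exists s : nat -> nat, (forall K, exists J, forall j, (J <= j)%nat -> (K <= s j)%nat) /\
    forall n, tends (fun j => recentred a (s j) n) (b n).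
Proof.
intros (nj & Hnj & Hb).
assert (Hs : forall K, exists J, forall j, (J <= j)%nat ->
  (K <= Z.to_nat (nj j))%nat /\ Z.of_nat (Z.to_nat (nj j)) = nj j).
{ intros K. apply is_lim_seq_spec in Hnj. destruct (Hnj (INR K)) as [J HJ].
  exists J. intros j Hj. specialize (HJ j Hj). rewrite INR_IZR_INZ in HJ. apply lt_IZR in HJ. lia. }
exists (fun j => Z.to_nat (nj j)). split.
- intros K. destruct (Hs K) as [J HJ]. exists J. intros j Hj. now apply HJ.
- intros n eps Heps.
  destruct (proj1 (tends_filterlim _ _) (Hb n) eps Heps) as [N HN].
  destruct (Hs (Z.abs_nat n)) as [J HJ].
  exists (max N J). intros j Hj. specialize (HN j ltac:(lia)).
  destruct (HJ j ltac:(lia)) as [H1 H2].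
  unfold recentred. rewrite H2. destruct (Z.leb_spec 0 (n + nj j)); [exact HN | lia].
Qed.

Lemma Cmod_recentred s n : Cmod (recentred a s n) <= A.
Proof.
unfold recentred. destruct (Z.leb _ _); [apply HA | ].
rewrite Cmod_0. apply bound_nonneg.
Qed.

Lemma right_limit_bound b : right_limit a b -> forall n, Cmod (b n) <= A.
Proof.
intros Hb n. destruct (right_limit_recentred b Hb) as (s & _ & Hre).
apply (tends_Cmod_le _ _ _ (Hre n)). intros j. apply Cmod_recentred.
Qed.

Context (t h : R) (Hh : 0 <= h).

(** For [r < 1] this is the integral of [hat t h x * f (r e^{i x}) * e^{i k x}],
    where [f] is the power series of [a]; for [r = 1] it is the same moment of the
    boundary distribution of [f]. *)
Definition twist (r : R) (k : Z) : C :=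
  CSeries (fun m => a m * (RtoC (r ^ m) * hat_moment t h (Z.of_nat m + k)))%C.

Lemma twist_dominated k : exists y Y, nonneg_series y Y /\
  forall r m, 0 <= r <= 1 ->
  Cmod (a m * (RtoC (r ^ m) * hat_moment t h (Z.of_nat m + k)))%C <= y m.
Proof.
destruct (hat_moment_bound t h Hh) as (K & HK & HKk).
generalize bound_nonneg. intros HA0.
set (c := A * (K * (INR (Z.abs_nat k) + 1) ^ 2)).
assert (Hc : 0 <= c).
{ apply Rmult_le_pos; [assumption | ].
  apply Rmult_le_pos; [assumption | apply pow2_ge_0]. }
destruct (invsq_nonneg_series c Hc) as [Y HY].
exists (fun m => c * invsq m), Y. split; [assumption | ].
intros r m Hr. rewrite !Cmod_mult, Cmod_R.
assert (Hr1 : 0 <= r ^ m <= 1).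
{ split; [apply pow_le; lra | ]. rewrite <- (pow1 m). apply pow_incr. lra. }
rewrite Rabs_pos_eq by lra.
unfold c. rewrite Rmult_assoc.
apply Rmult_le_compat; [apply Cmod_ge_0 | | apply HA | ].
- apply Rmult_le_pos; [lra | apply Cmod_ge_0].
- apply Rle_trans with (1 * (K * invsq (Z.abs_nat (Z.of_nat m + k)))).
  + apply Rmult_le_compat; [lra | apply Cmod_ge_0 | lra | apply HKk].
  + rewrite Rmult_1_l, Rmult_assoc. apply Rmult_le_compat_l; [assumption | ].
    apply invsq_shift. lia.
Qed.

Lemma twist_sums r k : 0 <= r <= 1 ->
  sums (fun m => a m * (RtoC (r ^ m) * hat_moment t h (Z.of_nat m + k)))%C (twist r k).
Proof.
intros Hr. destruct (twist_dominated k) as (y & Y & HY & Hy).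
destruct (dominated_sums _ y Y HY (fun m => Hy r m Hr)) as [s Hs].
unfold twist. now rewrite (CSeries_eq _ _ Hs).
Qed.

(** Abel summation: the moments of the boundary distribution are radial limits. *)
Lemma twist_radial k : tends (fun j => twist (radius j) k) (twist 1 k).
Proof.
destruct (twist_dominated k) as (y & Y & HY & Hy).
apply (tannery
  (fun j m => a m * (RtoC (radius j ^ m) * hat_moment t h (Z.of_nat m + k)))%C
  (fun j => twist (radius j) k)
  (fun m => a m * (RtoC (1 ^ m) * hat_moment t h (Z.of_nat m + k)))%C
  (twist 1 k) y Y HY).
- intros j m. apply Hy. generalize (radius_bounds j). lra.
- intros m. apply tends_scal.
  apply (tends_ext (fun j => hat_moment t h (Z.of_nat m + k) * RtoC (radius j ^ m))%C);
    [intros j; apply Cmult_comm | ].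
  rewrite Cmult_comm, pow1. apply tends_scal, radius_pow_tends_1.
- intros j. apply twist_sums. generalize (radius_bounds j). lra.
- apply twist_sums. lra.
Qed.

(** [f] has no negative frequencies, so only the rapidly decaying far Fourier
    coefficients of the triangle contribute. *)
Lemma twist_plus_tends_0 : tends (fun n => twist 1 (Z.of_nat n)) 0.
Proof.
destruct (hat_moment_bound t h Hh) as (K & HK & HKk).
generalize bound_nonneg. intros HA0.
destruct (invsq_nonneg_series (A * K)) as [Y HY]; [now apply Rmult_le_pos | ].
assert (Hle : forall n m, Cmod (a m * (RtoC (1 ^ m) * hat_moment t h (Z.of_nat m + Z.of_nat n)))%C
  <= A * K * invsq (m + n)).
{ intros n m. rewrite pow1, Cmult_1_l, Cmod_mult, Rmult_assoc.
  apply Rmult_le_compat; [apply Cmod_ge_0 | apply Cmod_ge_0 | apply HA | ].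
  replace (m + n)%nat with (Z.abs_nat (Z.of_nat m + Z.of_nat n)) by lia. apply HKk. }
apply (tannery
  (fun n m => a m * (RtoC (1 ^ m) * hat_moment t h (Z.of_nat m + Z.of_nat n)))%C
  (fun n => twist 1 (Z.of_nat n)) (fun _ => RtoC 0) 0 _ Y HY).
- intros n m. eapply Rle_trans; [apply (Hle n m) | ].
  apply Rmult_le_compat_l; [now apply Rmult_le_pos | ]. apply invsq_antitone. lia.
- intros m eps Heps.
  destruct (nonneg_series_tail _ _ HY eps Heps) as [N HN].
  exists (S N). intros n Hn. cbv beta.
  replace (a m * (RtoC (1 ^ m) * hat_moment t h (Z.of_nat m + Z.of_nat n)) - 0)%C
    with (a m * (RtoC (1 ^ m) * hat_moment t h (Z.of_nat m + Z.of_nat n)))%C by ring.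
  eapply Rle_lt_trans; [apply (Hle n m) | ].
  assert (Hn' : exists q, (m + n)%nat = S q /\ (N <= q)%nat) by (exists (m + n - 1)%nat; lia).
  destruct Hn' as (q & -> & Hq). specialize (HN q Hq).
  generalize (nonneg_series_sum_le _ _ (S q) HY). rewrite sum_Sn.
  change plus with Rplus. lra.
- intros n. apply twist_sums. lra.
- apply (tends_ext (fun _ => RtoC 0)); [ | apply tends_const].
  intros n. induction n as [|n IH]; [now rewrite Csum_0 | rewrite Csum_S, <- IH; ring].
Qed.

Lemma Cmod_power_term r m x : 0 <= r < 1 ->
  Cmod (a m * (RtoC (r ^ m) * expk (Z.of_nat m) x))%C <= A * r ^ m.
Proof.
intros Hr. rewrite !Cmod_mult, Cmod_R, Cmod_expk, Rmult_1_r.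
rewrite Rabs_pos_eq by (apply pow_le; lra).
apply Rmult_le_compat_r; [apply pow_le; lra | apply HA].
Qed.

Lemma power_series_sums r x : 0 <= r < 1 ->
  sums (fun m => a m * (RtoC (r ^ m) * expk (Z.of_nat m) x))%C
    (Cpower_series a (r * expi x)%C).
Proof.
intros Hr. destruct (geom_nonneg_series A r bound_nonneg ltac:(lra)) as [Y HY].
destruct (dominated_sums (fun m => a m * (RtoC (r ^ m) * expk (Z.of_nat m) x))%C _ _ HY) as [s Hs].
- intros m. now apply Cmod_power_term.
- unfold Cpower_series. rewrite (CSeries_eq _ s); [exact Hs | ].
  revert Hs. apply sums_ext. intros m. now rewrite expi_pow.
Qed.

Lemma Ccont_power_term r m x :
  Ccont (fun x => a m * (RtoC (r ^ m) * expk (Z.of_nat m) x))%C x.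
Proof.
apply Ccont_mult; [apply Ccont_const | ].
apply Ccont_mult; [apply Ccont_const | apply Ccont_expk].
Qed.

Lemma Ccont_power_series r x : 0 <= r < 1 ->
  Ccont (fun x => Cpower_series a (r * expi x)%C) x.
Proof.
intros Hr. destruct (geom_nonneg_series A r bound_nonneg ltac:(lra)) as [Y HY].
apply (dominated_sums_cont
  (fun m x => a m * (RtoC (r ^ m) * expk (Z.of_nat m) x))%C _ _ _ _ HY).
- intros m y. apply Ccont_power_term.
- intros m y. now apply Cmod_power_term.
- intros y. now apply power_series_sums.
Qed.

Lemma Ccont_eval p x : Ccont (eval p) x.
Proof.
induction p as [|[k c] p IH]; [apply (Ccont_const 0) | ].
apply (Ccont_plus (fun x => c * expk k x)%C (eval p)); [ | exact IH].
apply Ccont_mult; [apply Ccont_const | apply Ccont_expk].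
Qed.

Context (alpha beta : R) (Ht : alpha <= t - h /\ t + h <= beta).
Context (M : R) (HM : forall r, 0 < r < 1 ->
  RInt (fun theta => Cmod (Cpower_series a (r * expi theta)%C) / (2 * PI)) alpha beta <= M).

Lemma local_mass r : 0 < r < 1 ->
  RInt (fun x => Cmod (Cpower_series a (r * expi x)%C)) (t - h) (t + h) <= 2 * PI * M.
Proof.
intros Hr. generalize PI_RGT_0. intros HPI.
set (g := fun x => Cmod (Cpower_series a (r * expi x)%C)).
assert (Hg : forall u v, ex_RInt g u v).
{ intros u v. apply (ex_RInt_continuous (V := R_CompleteNormedModule)).
  intros x _. apply Ccont_Cmod, Ccont_power_series. lra. }
assert (Hpos : forall u v, u <= v -> 0 <= RInt g u v).
{ intros u v Huv. apply RInt_ge_0; [assumption | apply Hg | intros x _; apply Cmod_ge_0]. }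
assert (E : RInt (fun theta => Cmod (Cpower_series a (r * expi theta)%C) / (2 * PI)) alpha beta
  = / (2 * PI) * RInt g alpha beta).
{ apply is_RInt_unique.
  apply (is_RInt_ext (fun x => scal (/ (2 * PI)) (g x))).
  - intros x _. apply Rmult_comm.
  - apply (is_RInt_scal (V := R_NormedModule)).
    apply (RInt_correct (V := R_CompleteNormedModule)), Hg. }
assert (E2 : RInt g alpha beta = RInt g alpha (t - h) + (RInt g (t - h) (t + h) + RInt g (t + h) beta)).
{ rewrite <- (RInt_Chasles (V := R_CompleteNormedModule) g alpha (t - h) beta) by apply Hg.
  now rewrite <- (RInt_Chasles (V := R_CompleteNormedModule) g (t - h) (t + h) beta) by apply Hg. }
generalize (Hpos alpha (t - h) ltac:(lra)) (Hpos (t + h) beta ltac:(lra)) (HM r Hr).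
rewrite E. intros H1 H2 H3.
apply Rmult_le_compat_l with (r := 2 * PI) in H3; [ | lra].
rewrite <- Rmult_assoc, Rinv_r, Rmult_1_l in H3 by lra. lra.
Qed.

(** The moments at radius [r] come from the function [hat * f], whose [L^1] norm is
    bounded uniformly in [r]. To stay with trigonometric polynomials, [f] is
    replaced by its partial sums [S n]. The constant is 2 from [CInt_Cmod_le], the
    height [h] of the triangle, and [2 * PI * M] from [local_mass]. *)
Lemma moment_twist_radial r p B : 0 < r < 1 -> (forall x, Cmod (eval p x) <= B) ->
  Cmod (moment (twist r) p) <= 4 * PI * h * M * B.
Proof.
intros Hr HB.
assert (HB0 : 0 <= B) by (apply Rle_trans with (2 := HB 0), Cmod_ge_0).
set (S := fun n x => Csum (fun m => a m * (RtoC (r ^ m) * expk (Z.of_nat m) x))%C n).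
set (P := fun n (k : Z) =>
  Csum (fun m => a m * (RtoC (r ^ m) * hat_moment t h (Z.of_nat m + k)))%C n).
assert (HS : forall n x, Ccont (S n) x).
{ intros n x. apply (Ccont_Csum (fun m x => a m * (RtoC (r ^ m) * expk (Z.of_nat m) x))%C).
  intros m. apply Ccont_power_term. }
assert (HhS : forall n x, Ccont (fun x => RtoC (hat t h x) * S n x)%C x).
{ intros n x. apply Ccont_mult; [apply Ccont_hat | apply HS]. }
assert (HP : forall n k, P n k =
  CInt (fun x => RtoC (hat t h x) * S n x * expk k x)%C (t - h) (t + h)).
{ intros n k. unfold P, S.
  rewrite (CInt_ext (t - h) (t + h) ltac:(lra) _ (fun x => Csum (fun m =>
    (a m * RtoC (r ^ m)) * (RtoC (hat t h x) * expk (Z.of_nat m + k) x))%C n)).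
  - rewrite (CInt_Csum (t - h) (t + h) ltac:(lra) (fun m x =>
      (a m * RtoC (r ^ m)) * (RtoC (hat t h x) * expk (Z.of_nat m + k) x))%C).
    + apply Csum_ext. intros m _. rewrite CInt_scal; [unfold hat_moment; ring | lra | ].
      intros x _. apply Ccont_mult; [apply Ccont_hat | apply Ccont_expk].
    + intros m x _. apply Ccont_mult; [apply Ccont_const | ].
      apply Ccont_mult; [apply Ccont_hat | apply Ccont_expk].
  - intros x _. rewrite <- Cmult_assoc, (Cmult_comm _ (expk k x)), Cmult_assoc, Csum_mult.
    apply Csum_ext. intros m _. rewrite expk_plus. ring. }
assert (Hpair : forall n, moment (P n) p =
  CInt (fun x => RtoC (hat t h x) * S n x * eval p x)%C (t - h) (t + h)).
{ intros n. clear HB. induction p as [|[k c] q IH].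
  - symmetry. rewrite (CInt_ext (t - h) (t + h) ltac:(lra) _ (fun x => RtoC 0 * RtoC 0)%C).
    + rewrite (CInt_scal (t - h) (t + h) ltac:(lra) 0 (fun _ => RtoC 0)); [ | intros x _; apply Ccont_const].
      simpl. ring.
    + intros x _. simpl. ring.
  - rewrite moment_cons, IH, HP.
    rewrite <- CInt_scal, <- CInt_plus; try lra.
    + apply CInt_ext; [lra | ]. intros x _. rewrite eval_cons. ring.
    + intros x _. apply Ccont_mult; [apply Ccont_const | ].
      apply Ccont_mult; [apply HhS | apply Ccont_expk].
    + intros x _. apply Ccont_mult; [apply HhS | apply Ccont_eval].
    + intros x _. apply Ccont_mult; [apply HhS | apply Ccont_expk]. }
apply (tends_Cmod_le_approx (fun n => moment (P n) p)).
- apply tends_moment. intros k. apply twist_sums. lra.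
- intros eps Heps.
  destruct (geom_nonneg_series A r bound_nonneg ltac:(lra)) as [Y HY].
  assert (HhhB : 0 <= h * h * B) by (rewrite Rmult_assoc; repeat apply Rmult_le_pos; lra).
  destruct (nonneg_series_tail _ _ HY (eps / (4 * (h * h * B) + 1))) as [N HN].
  { apply Rdiv_lt_0_compat; lra. }
  exists N. intros n Hn. specialize (HN n Hn).
  assert (Hd0 := Rge_le _ _ (Rge_minus _ _ (Rle_ge _ _ (nonneg_series_sum_le _ _ n HY)))).
  set (d := Y - sum_n (fun m => A * r ^ m) n) in *.
  set (f := fun x => Cmod (Cpower_series a (r * expi x)%C)).
  set (g := fun x => h * B * (f x + d)).
  assert (Hf : ex_RInt f (t - h) (t + h)).
  { apply (ex_RInt_continuous (V := R_CompleteNormedModule)).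
    intros x _. apply Ccont_Cmod, Ccont_power_series. lra. }
  assert (Hg : is_RInt g (t - h) (t + h) (h * B * (RInt f (t - h) (t + h) + 2 * h * d))).
  { apply (is_RInt_scal (V := R_NormedModule) (fun x => f x + d)).
    apply (is_RInt_plus (V := R_NormedModule) f (fun _ => d)).
    - now apply (RInt_correct (V := R_CompleteNormedModule)).
    - replace (2 * h * d) with (((t + h) - (t - h)) * d) by ring.
      apply (is_RInt_const (V := R_NormedModule)). }
  rewrite Hpair.
  apply Rle_trans with (2 * RInt g (t - h) (t + h)).
  + apply CInt_Cmod_le; [lra | | now eexists; apply Hg | ].
    * intros x _. apply Ccont_mult; [apply HhS | apply Ccont_eval].
    * intros x Hx. rewrite !Cmod_mult, Cmod_R.
      generalize (hat_bounds t h x Hx). intros Hhat. rewrite Rabs_pos_eq by lra.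
      assert (HSx : Cmod (S n x) <= f x + d).
      { eapply Rle_trans; [apply (Cmod_sub_le _ (Cpower_series a (r * expi x)%C)) | ].
        apply Rplus_le_compat_l. rewrite Cmod_sub_sym.
        apply dominated_tail with (1 := HY).
        - intros m. apply Cmod_power_term. lra.
        - apply power_series_sums. lra. }
      unfold g. replace (h * B * (f x + d)) with (h * (f x + d) * B) by ring.
      apply Rmult_le_compat; [ | apply Cmod_ge_0 | | apply HB].
      -- apply Rmult_le_pos; [lra | apply Cmod_ge_0].
      -- apply Rmult_le_compat; [lra | apply Cmod_ge_0 | lra | exact HSx].
  + rewrite (is_RInt_unique _ _ _ _ Hg).
    assert (HhB : 0 <= h * B) by now apply Rmult_le_pos.
    assert (H1 : h * B * RInt f (t - h) (t + h) <= h * B * (2 * PI * M))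
      by (apply Rmult_le_compat_l; [assumption | now apply local_mass]).
    assert (H2 : (4 * (h * h * B)) * d <= eps).
    { apply Rle_trans with ((4 * (h * h * B) + 1) * (eps / (4 * (h * h * B) + 1))).
      - apply Rmult_le_compat; lra.
      - right. field. lra. }
    lra.
Qed.

(** Positive frequencies of [f] are where its coefficients sit, so this is not a
    matter of size: it needs the [L^1] bound, through [one_sided_decay]. *)
Lemma twist_minus_tends_0 : tends (fun n => twist 1 (- Z.of_nat n)%Z) 0.
Proof.
apply one_sided_decay with (4 * PI * h * M).
- intros p B HB.
  apply (tends_Cmod_le (fun j => moment (twist (radius j)) p)).
  + apply (tends_moment (fun j => twist (radius j))). intros k. apply twist_radial.
  + intros j. apply moment_twist_radial; [apply radius_bounds | assumption].
- apply twist_plus_tends_0.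
Qed.

(** The pairing of [b] with the triangle is the limit, by dominated convergence, of
    the pairings of the shifted sequences [a]; these are the moments [twist 1 (- s)]
    along [s = s j], which tend to zero. *)
Lemma right_limit_hat_vanishes b : right_limit a b ->
  sums (two_sided (fun n => b n * hat_moment t h n)%C) 0.
Proof.
intros Hb. assert (Hbb := right_limit_bound b Hb).
destruct (right_limit_recentred b Hb) as (s & Hs & Hre).
destruct (hat_moment_bound t h Hh) as (K & HK & HKk).
generalize bound_nonneg. intros HA0.
destruct (invsq_nonneg_series (2 * (A * K))) as [Y HY].
{ apply Rmult_le_pos; [lra | now apply Rmult_le_pos]. }
assert (Hdom : forall (g : Z -> C) k, (forall n, Cmod (g n) <= A) ->
  Cmod (two_sided (fun n => g n * hat_moment t h n)%C k) <= 2 * (A * K) * invsq k).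
{ intros g k Hg.
  assert (H1 : forall n, Cmod (g n * hat_moment t h n)%C <= A * K * invsq (Z.abs_nat n)).
  { intros n. rewrite Cmod_mult, Rmult_assoc.
    apply Rmult_le_compat; auto; apply Cmod_ge_0. }
  assert (H0 : 0 <= A * K * invsq k).
  { apply Rmult_le_pos; [now apply Rmult_le_pos | left; apply invsq_pos]. }
  destruct k as [|k].
  - cbn [two_sided]. generalize (H1 0%Z). change (Z.abs_nat 0) with 0%nat. lra.
  - cbn [two_sided]. eapply Rle_trans; [apply Cmod_triangle | ].
    generalize (H1 (Z.of_nat (S k))) (H1 (- Z.of_nat (S k))%Z).
    replace (Z.abs_nat (Z.of_nat (S k))) with (S k) by lia.
    replace (Z.abs_nat (- Z.of_nat (S k))) with (S k) by lia. lra. }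
destruct (dominated_sums (two_sided (fun n => b n * hat_moment t h n)%C) _ _ HY) as [l Hl].
{ intros k. now apply Hdom. }
replace (RtoC 0) with l; [exact Hl | ].
apply (tends_unique (fun j => twist 1 (- Z.of_nat (s j))%Z)).
- apply (tannery (fun j => two_sided (fun n => recentred a (s j) n * hat_moment t h n)%C)
    (fun j => twist 1 (- Z.of_nat (s j))%Z)
    (two_sided (fun n => b n * hat_moment t h n)%C) l _ Y HY).
  + intros j k. apply Hdom. intros n. apply Cmod_recentred.
  + assert (H1 : forall n, tends (fun j => recentred a (s j) n * hat_moment t h n)%C
      (b n * hat_moment t h n)%C).
    { intros n. apply (tends_ext (fun j => hat_moment t h n * recentred a (s j) n)%C);
        [intros j; apply Cmult_comm | ].
      rewrite (Cmult_comm (b n)). apply tends_scal, Hre. }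
    intros [|k]; [apply H1 | ]. cbn [two_sided]. apply tends_plus; apply H1.
  + intros j. apply sums_recentred.
    apply (sums_ext (fun m => a m * (RtoC (1 ^ m) * hat_moment t h (Z.of_nat m + - Z.of_nat (s j))))%C).
    * intros m. rewrite pow1, Cmult_1_l. reflexivity.
    * apply twist_sums. lra.
  + exact Hl.
- apply (tends_subseq (fun n => twist 1 (- Z.of_nat n)%Z)).
  + intros N. destruct (Hs N) as [J HJ]. exists J. intros j Hj. now apply HJ.
  + apply twist_minus_tends_0.
Qed.

End Twist.

(** * The second primitive *)

Definition prim_term (b : Z -> C) (k : nat) (x : R) : C :=
  (- RtoC (invsq k) * (b (Z.of_nat (S k)) * expk (Z.of_nat (S k)) x
                       + b (- Z.of_nat (S k))%Z * expk (- Z.of_nat (S k)) x))%C.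

(** Integrating the distribution [sum_n b n e^{i n x}], less its mean [b 0],
    twice gives a continuous function. *)
Definition prim (b : Z -> C) (x : R) : C := CSeries (fun k => prim_term b k x).

Section Primitive.

Context (b : Z -> C) (A : R) (HA : forall n, Cmod (b n) <= A).

Lemma prim_nonneg_series : exists Y, nonneg_series (fun k => 2 * A * invsq k) Y.
Proof.
apply invsq_nonneg_series. generalize (Cmod_ge_0 (b 0%Z)) (HA 0%Z). lra.
Qed.

Lemma Cmod_prim_term k x : Cmod (prim_term b k x) <= 2 * A * invsq k.
Proof.
unfold prim_term. rewrite Cmod_mult, Cmod_opp, Cmod_R.
generalize (invsq_pos k). intros Hk. rewrite Rabs_pos_eq by lra.
rewrite Rmult_comm. apply Rmult_le_compat_r; [lra | ].
eapply Rle_trans; [apply Cmod_triangle | ].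
rewrite !Cmod_mult, !Cmod_expk.
generalize (HA (Z.of_nat (S k))) (HA (- Z.of_nat (S k))%Z). lra.
Qed.

Lemma Ccont_prim_term k x : Ccont (prim_term b k) x.
Proof.
apply Ccont_mult; [apply Ccont_const | ].
apply Ccont_plus; apply Ccont_mult; apply Ccont_const || apply Ccont_expk.
Qed.

Lemma prim_sums x : sums (fun k => prim_term b k x) (prim b x).
Proof.
destruct prim_nonneg_series as [Y HY].
destruct (dominated_sums (fun k => prim_term b k x) _ _ HY) as [s Hs].
- intros k. apply Cmod_prim_term.
- unfold prim. now rewrite (CSeries_eq _ _ Hs).
Qed.

Lemma Ccont_prim x : Ccont (prim b) x.
Proof.
destruct prim_nonneg_series as [Y HY].
apply (dominated_sums_cont (prim_term b) (prim b) _ _ _ HY).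
- intros k t. apply Ccont_prim_term.
- intros k t. apply Cmod_prim_term.
- apply prim_sums.
Qed.

Lemma prim_bounded : exists B, forall x, Cmod (prim b x) <= B.
Proof.
destruct prim_nonneg_series as [Y HY]. exists Y. intros x.
apply (tends_Cmod_le _ _ _ (prim_sums x)). intros n.
apply Rle_trans with (2 := nonneg_series_sum_le _ _ n HY).
induction n as [|n IH].
- rewrite Csum_0, sum_O. apply Cmod_prim_term.
- rewrite Csum_S, sum_Sn. eapply Rle_trans; [apply Cmod_triangle | ].
  apply Rplus_le_compat; [exact IH | apply Cmod_prim_term].
Qed.

Lemma invsq_inv k : (RtoC (invsq k) * RtoC (IZR (Z.of_nat (S k)) ^ 2))%C = 1.
Proof.
rewrite <- RtoC_mult. f_equal. unfold invsq. rewrite <- INR_IZR_INZ, S_INR.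
field. generalize (pos_INR k). lra.
Qed.

(** The triangle is the kernel of the second difference, so pairing with it is
    taking a second difference of the second primitive; the mean [b 0], which the
    primitive leaves out, contributes the area [h ^ 2] of the triangle. *)
Lemma prim_second_diff t h : 0 <= h ->
  sums (two_sided (fun n => b n * hat_moment t h n)%C) 0 ->
  second_diff (prim b) t h = (- (b 0%Z * RtoC (h ^ 2)))%C.
Proof.
intros Hh H0. apply sums_incr in H0.
apply (tends_unique (Csum (fun k => second_diff (prim_term b k) t h))).
- unfold second_diff. apply sums_plus; [ | apply prim_sums].
  unfold Cminus. apply sums_plus; [apply prim_sums | ].
  apply (sums_ext (fun k => - (2) * prim_term b k t)%C); [intros k; ring | ].
  replace (- (2 * prim b t))%C with (- (2) * prim b t)%C by ring.
  apply sums_scal, prim_sums.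
- replace (- (b 0%Z * RtoC (h ^ 2)))%C with
    (0 - two_sided (fun n => b n * hat_moment t h n) 0)%C
    by (cbn [two_sided]; rewrite hat_moment_0 by assumption; ring).
  revert H0. apply sums_ext. intros k. cbn [two_sided].
  transitivity (- RtoC (invsq k) *
    (b (Z.of_nat (S k)) * second_diff (expk (Z.of_nat (S k))) t h
     + b (- Z.of_nat (S k))%Z * second_diff (expk (- Z.of_nat (S k))) t h))%C.
  + rewrite <- !hat_moment_second_diff by assumption.
    rewrite opp_IZR. replace ((- IZR (Z.of_nat (S k))) ^ 2) with (IZR (Z.of_nat (S k)) ^ 2) by ring.
    set (X := hat_moment t h (Z.of_nat (S k))). set (Y := hat_moment t h (- Z.of_nat (S k))).
    transitivity ((RtoC (invsq k) * RtoC (IZR (Z.of_nat (S k)) ^ 2)) *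
      (b (Z.of_nat (S k)) * X + b (- Z.of_nat (S k))%Z * Y))%C; [ | ring].
    rewrite invsq_inv. ring.
  + unfold second_diff, prim_term. ring.
Qed.

End Primitive.

(** * Functions with vanishing second differences are affine *)

(** Reflect the nearer endpoint through a maximum point: the maximal value is then
    the mean of 0 and of another value, which is at most the maximum. *)
Lemma midpoint_max_principle (g : R -> R) alpha beta : alpha <= beta ->
  (forall x, alpha <= x <= beta -> continuity_pt g x) ->
  (forall t h, 0 <= h -> alpha <= t - h -> t + h <= beta -> g (t + h) + g (t - h) = 2 * g t) ->
  g alpha = 0 -> g beta = 0 -> forall x, alpha <= x <= beta -> g x <= 0.
Proof.
intros Hab Hc Hmid H1 H2 x Hx.
destruct (continuity_ab_maj g alpha beta Hab Hc) as (m & Hm & Hmab).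
apply Rle_trans with (1 := Hm x Hx).
destruct (Rle_or_lt (m - alpha) (beta - m)) as [H|H].
- generalize (Hmid m (m - alpha) ltac:(lra) ltac:(lra) ltac:(lra)).
  replace (m - (m - alpha)) with alpha by ring. rewrite H1.
  generalize (Hm (m + (m - alpha)) ltac:(lra)). lra.
- generalize (Hmid m (beta - m) ltac:(lra) ltac:(lra) ltac:(lra)).
  replace (m + (beta - m)) with beta by ring. rewrite H2.
  generalize (Hm (m - (beta - m)) ltac:(lra)). lra.
Qed.

Lemma second_diff_zero_affine (E : R -> C) alpha beta : alpha < beta ->
  (forall x, Ccont E x) ->
  (forall t h, 0 <= h -> alpha <= t - h -> t + h <= beta -> second_diff E t h = 0) ->
  exists c d : C, forall x, alpha <= x <= beta -> E x = (c * x + d)%C.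
Proof.
intros Hab HE Hsd.
assert (Hne : RtoC (beta - alpha) <> 0) by (intros Eq; apply RtoC_inj in Eq; lra).
set (c := ((E beta - E alpha) / RtoC (beta - alpha))%C).
set (d := (E alpha - c * alpha)%C).
exists c, d.
set (G := fun x : R => (E x + - (c * x + d))%C).
assert (HG : forall x, Ccont G x).
{ intros x. apply Ccont_plus; [apply HE | ]. apply Ccont_opp.
  apply Ccont_plus; [ | apply Ccont_const].
  apply Ccont_mult; [apply Ccont_const | eapply Cderiv_cont, Cderiv_id]. }
assert (HGsd : forall t h, 0 <= h -> alpha <= t - h -> t + h <= beta ->
  (G (t + h)%R + G (t - h)%R)%C = (2 * G t)%C).
{ intros t h H1 H2 H3. generalize (Hsd t h H1 H2 H3). unfold second_diff, G. intros H.
  rewrite RtoC_plus, RtoC_minus.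
  transitivity ((E (t + h)%R - 2 * E t + E (t - h)%R) + 2 * (E t + - (c * t + d)))%C; [ring | ].
  rewrite H. ring. }
assert (HGa : G alpha = 0) by (unfold G, d; ring).
assert (HGb : G beta = 0).
{ unfold G, d. replace (E beta) with (E alpha + c * RtoC (beta - alpha))%C.
  - rewrite RtoC_minus. ring.
  - unfold c. field. exact Hne. }
assert (P : forall pr : C -> R,
  (forall z w, pr (z + w)%C = pr z + pr w) -> (forall z, pr (2 * z)%C = 2 * pr z) ->
  pr 0 = 0 -> (forall x, continuous (fun t => pr (G t)) x) ->
  forall x, alpha <= x <= beta -> pr (G x) <= 0).
{ intros pr Hp Hs H0 Hc.
  apply (midpoint_max_principle (fun t => pr (G t))); [lra | | | now rewrite HGa | now rewrite HGb].
  - intros x _. apply continuity_pt_filterlim, Hc.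
  - intros t h H1 H2 H3. rewrite <- Hp, HGsd by assumption. apply Hs. }
intros x Hx.
assert (F1 := P fst (fun z w => eq_refl) ltac:(intros; simpl; ring) eq_refl (fun x => proj1 (HG x)) x Hx).
assert (F2 := P snd (fun z w => eq_refl) ltac:(intros; simpl; ring) eq_refl (fun x => proj2 (HG x)) x Hx).
assert (F3 := P (fun z => - fst z) ltac:(intros; simpl; ring) ltac:(intros; simpl; ring) Ropp_0
  (fun x => continuous_opp (K := R_AbsRing) (V := R_NormedModule) _ _ (proj1 (HG x))) x Hx).
assert (F4 := P (fun z => - snd z) ltac:(intros; simpl; ring) ltac:(intros; simpl; ring) Ropp_0
  (fun x => continuous_opp (K := R_AbsRing) (V := R_NormedModule) _ _ (proj2 (HG x))) x Hx).
cbv beta in F3, F4.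
assert (HG0 : G x = 0).
{ rewrite (surjective_pairing (G x)). unfold RtoC. f_equal; lra. }
replace (E x) with (G x + (c * x + d))%C by (unfold G; ring).
rewrite HG0. ring.
Qed.

(** * The Cauchy kernel on the circle *)

(** The Cauchy kernel [zeta / (zeta - z)] at [zeta = expi theta]. *)
Definition kernel (z : C) (theta : R) : C := (/ (1 - expi (- theta) * z))%C.

(** First and second [theta]-derivatives of the kernel, as polynomials in it. *)
Definition kernel1 (u : C) : C := (Ci * (u + - (u * u)))%C.
Definition kernel2 (u : C) : C := (- (u + - (3 * (u * u)) + 2 * (u * u * u)))%C.

Lemma Cderiv_inv (f : R -> C) x l : f x <> RtoC 0 -> Cderiv f x l ->
  Cderiv (fun t => / f t)%C x (- l * (/ f x * / f x))%C.
Proof.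
intros Hf [H1 H2].
assert (Hn : fst (f x) ^ 2 + snd (f x) ^ 2 <> 0).
{ rewrite <- Cmod_sqr. apply Rgt_not_eq, pow_lt. now apply Cmod_gt_0. }
assert (P : forall (u v : R -> R) (p q : R), u x ^ 2 + v x ^ 2 <> 0 ->
  is_derive u x p -> is_derive v x q ->
  is_derive (fun t => u t / (u t ^ 2 + v t ^ 2)) x
    ((p * (v x ^ 2 - u x ^ 2) - 2 * q * u x * v x) / (u x ^ 2 + v x ^ 2) ^ 2)).
{ clear. intros u v p q Hn Hu Hv.
  assert (Eu : ex_derive u x) by now exists p.
  assert (Ev : ex_derive v x) by now exists q.
  auto_derive; [simpl in Hn; tauto | ].
  replace (Derive (fun y => u y) x) with p by (symmetry; now apply is_derive_unique).
  replace (Derive (fun y => v y) x) with q by (symmetry; now apply is_derive_unique).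
  field. simpl in Hn. lra. }
split.
- eapply is_derive_eq; [ | apply (P _ _ _ _ Hn H1 H2)].
  simpl. field. simpl in Hn. lra.
- assert (Hn' : (- snd (f x)) ^ 2 + fst (f x) ^ 2 <> 0).
  { replace ((- snd (f x)) ^ 2 + fst (f x) ^ 2) with (fst (f x) ^ 2 + snd (f x) ^ 2) by ring.
    exact Hn. }
  apply (is_derive_ext (fun t => - snd (f t) / ((- snd (f t)) ^ 2 + fst (f t) ^ 2))).
  + intros t.
    replace ((- snd (f t)) ^ 2 + fst (f t) ^ 2) with (fst (f t) ^ 2 + snd (f t) ^ 2) by ring.
    reflexivity.
  + eapply is_derive_eq; [ | apply (P (fun t => - snd (f t)) (fun t => fst (f t)) (- snd l) (fst l) Hn');
      [ | exact H1]].
    * simpl. field. simpl in Hn, Hn'. lra.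
    * now apply (is_derive_opp (K := R_AbsRing) (V := R_NormedModule) (fun t => snd (f t))).
Qed.

Lemma Cderiv_expi_opp x : Cderiv (fun t => expi (- t)) x (- (Ci * expi (- x)))%C.
Proof.
apply (Cderiv_ext (fun t => expi (-1 * t))).
- intros t. f_equal. ring.
- eapply Cderiv_eq; [apply Cderiv_expi | ].
  replace (-1 * x) with (- x) by ring. ring.
Qed.

Lemma Cderiv_kernel z x : (1 - expi (- x) * z)%C <> RtoC 0 ->
  Cderiv (kernel z) x (kernel1 (kernel z x)).
Proof.
intros Hz. eapply Cderiv_eq.
- apply (Cderiv_inv (fun t => 1 - expi (- t) * z)%C); [exact Hz | ].
  unfold Cminus. apply Cderiv_plus; [apply Cderiv_const | ].
  apply (Cderiv_ext (fun t => expi (- t) * (- z))%C); [intros t; ring | ].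
  apply Cderiv_mult; [apply Cderiv_expi_opp | apply Cderiv_const].
- unfold kernel1, kernel. field. exact Hz.
Qed.

Lemma Cderiv_kernel1 z x : (1 - expi (- x) * z)%C <> RtoC 0 ->
  Cderiv (fun t => kernel1 (kernel z t)) x (kernel2 (kernel z x)).
Proof.
intros Hz. assert (H := Cderiv_kernel z x Hz). eapply Cderiv_eq.
- apply Cderiv_mult; [apply Cderiv_const | ].
  apply Cderiv_plus; [exact H | ].
  apply (Cderiv_ext (fun t => (- (1)) * (kernel z t * kernel z t))%C); [intros t; ring | ].
  apply Cderiv_mult; [apply Cderiv_const | ]. apply Cderiv_mult; exact H.
- unfold kernel1, kernel2. set (u := kernel z x).
  assert (Hi : (Ci * Ci)%C = (- (1))%C).
  { unfold Ci, Cmult, Copp, RtoC; simpl. f_equal; ring. }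
  transitivity ((Ci * Ci) * ((u + - (u * u)) * (1 - 2 * u)))%C; [ring | rewrite Hi; ring].
Qed.

Lemma Ccont_kernel2 k x : Ccont k x -> Ccont (fun t => kernel2 (k t)) x.
Proof.
intros H. assert (H2 : Ccont (fun t => k t * k t)%C x) by now apply Ccont_mult.
apply Ccont_opp. apply Ccont_plus.
- apply Ccont_plus; [exact H | ]. apply Ccont_opp.
  apply Ccont_mult; [apply Ccont_const | exact H2].
- apply Ccont_mult; [apply Ccont_const | ].
  apply (Ccont_mult (fun t => k t * k t)%C k); assumption.
Qed.

Lemma expi_period x : expi (x + 2 * PI) = expi x.
Proof.
rewrite expi_plus. replace (expi (2 * PI)) with (RtoC 1); [apply Cmult_1_r | ].
unfold expi. now rewrite cos_2PI, sin_2PI.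
Qed.

Lemma expk_period k x : expk k (x + 2 * PI) = expk k x.
Proof.
assert (H : forall n, expk (Z.of_nat n) (x + 2 * PI) = expk (Z.of_nat n) x).
{ induction n as [|n IH]; [now rewrite !expk_0 | ].
  rewrite Nat2Z.inj_succ. unfold Z.succ. rewrite !expk_plus, IH. f_equal.
  unfold expk. rewrite !Rmult_1_l. apply expi_period. }
destruct (Z_le_gt_dec 0 k) as [Hk|Hk].
- rewrite <- (Z2Nat.id k Hk). apply H.
- replace k with (- Z.of_nat (Z.to_nat (- k)))%Z by lia. now rewrite !expk_opp, H.
Qed.

Lemma kernel_period z x : kernel z (x + 2 * PI) = kernel z x.
Proof. unfold kernel. now rewrite !expi_opp, expi_period. Qed.

Lemma kernel_denominator z x : Rabs (1 - Cmod z) <= Cmod (1 - expi (- x) * z)%C.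
Proof.
assert (E : Cmod (expi (- x) * z)%C = Cmod z) by (rewrite Cmod_mult, Cmod_expi; ring).
generalize (Cmod_sub_le 1 (expi (- x) * z)%C) (Cmod_sub_le (expi (- x) * z)%C 1).
rewrite (Cmod_sub_sym (expi (- x) * z)%C), Cmod_1, E. intros. apply Rabs_le. lra.
Qed.

Section Moments.

Context (alpha : R) (z : C) (Hz : Cmod z <> 1).

Lemma kernel_denominator_neq_0 x : (1 - expi (- x) * z)%C <> RtoC 0.
Proof.
apply Cmod_gt_0. apply Rlt_le_trans with (2 := kernel_denominator z x).
apply Rabs_pos_lt. lra.
Qed.

Lemma Ccont_kernel x : Ccont (kernel z) x.
Proof. eapply Cderiv_cont, Cderiv_kernel, kernel_denominator_neq_0. Qed.

Lemma Cmod_kernel x : Cmod (kernel z x) <= / Rabs (1 - Cmod z).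
Proof.
unfold kernel. rewrite Cmod_inv by apply kernel_denominator_neq_0.
apply Rinv_le_contravar; [apply Rabs_pos_lt; lra | apply kernel_denominator].
Qed.

Lemma period_le : alpha <= alpha + 2 * PI.
Proof. generalize PI_RGT_0. lra. Qed.

Definition kernel_moment (n : Z) : C :=
  CInt (fun x => expk n x * kernel z x)%C alpha (alpha + 2 * PI).

Lemma Ccont_moment n x : Ccont (fun x => expk n x * kernel z x)%C x.
Proof. apply Ccont_mult; [apply Ccont_expk | apply Ccont_kernel]. Qed.

Lemma CInt_expk n : n <> 0%Z -> CInt (expk n) alpha (alpha + 2 * PI) = 0.
Proof.
intros Hn.
assert (Hw : (Ci * IZR n)%C <> RtoC 0).
{ apply Cmult_neq_0; [apply Ci_nz | ]. intros E. apply RtoC_inj in E. now apply eq_IZR in E. }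
assert (H : (Ci * IZR n * CInt (expk n) alpha (alpha + 2 * PI))%C = 0).
{ rewrite <- (CInt_scal _ _ period_le) by (intros x _; apply Ccont_expk).
  rewrite (CInt_FTC _ _ period_le (expk n)).
  - rewrite expk_period. ring.
  - intros x _. apply (Cderiv_expi (IZR n)).
  - intros x _. apply Ccont_mult; [apply Ccont_const | apply Ccont_expk]. }
destruct (Ceq_dec (CInt (expk n) alpha (alpha + 2 * PI)) 0) as [|Hne]; [assumption | ].
now apply (Cmult_neq_0 _ _ Hw) in Hne.
Qed.

Lemma CInt_expk_0 : CInt (expk 0) alpha (alpha + 2 * PI) = RtoC (2 * PI).
Proof.
rewrite (CInt_FTC _ _ period_le (fun t => RtoC t)).
- rewrite <- RtoC_minus. f_equal. ring.
- intros x _. rewrite expk_0. apply Cderiv_id.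
- intros x _. apply Ccont_expk.
Qed.

(** The kernel [u] satisfies [u = 1 + z zeta^{-1} u]. *)
Lemma kernel_moment_step n :
  kernel_moment n = (CInt (expk n) alpha (alpha + 2 * PI) + z * kernel_moment (n - 1))%C.
Proof.
unfold kernel_moment.
rewrite <- (CInt_scal _ _ period_le) by (intros x _; apply Ccont_moment).
rewrite <- (CInt_plus _ _ period_le).
- apply CInt_ext; [apply period_le | ]. intros x _.
  replace n with ((n - 1) + 1)%Z at 1 2 by lia. rewrite expk_plus.
  replace (expk 1 x) with (/ expi (- x))%C.
  + unfold kernel. field. split; [apply kernel_denominator_neq_0 | apply expi_neq_0].
  + unfold expk. rewrite Rmult_1_l.
    replace (/ expi (- x))%C with (/ expi (- x) * (expi (- x) * expi x))%C.
    * field. apply expi_neq_0.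
    * rewrite <- expi_plus, Rplus_opp_l, expi_0. ring.
- intros x _. apply Ccont_expk.
- intros x _. apply Ccont_mult; [apply Ccont_const | apply Ccont_moment].
Qed.

Lemma kernel_moment_bounded : exists B, forall n, Cmod (kernel_moment n) <= B.
Proof.
exists (2 * ((alpha + 2 * PI - alpha) * / Rabs (1 - Cmod z))). intros n.
apply CInt_Cmod_le_const; [apply period_le | intros x _; apply Ccont_moment | ].
intros x _. rewrite Cmod_mult, Cmod_expk, Rmult_1_l. apply Cmod_kernel.
Qed.

(** Iterating the recursion gives [x 0 = w ^ k * x k], which tends to zero. *)
Lemma bounded_contraction_0 (x : nat -> C) w B :
  Cmod w < 1 -> (forall k, Cmod (x k) <= B) -> (forall k, x k = (w * x (S k))%C) ->
  x 0%nat = 0.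
Proof.
intros Hw HB Hx.
assert (Hpow : forall k, x 0%nat = (w ^ k * x k)%C).
{ induction k as [|k IH]; [simpl; ring | ]. rewrite IH, (Hx k), Cpow_S. ring. }
destruct (Ceq_dec (x 0%nat) 0) as [|Hne]; [assumption | exfalso].
apply Cmod_gt_0 in Hne.
assert (HB0 : 0 < B) by (apply Rlt_le_trans with (1 := Hne), HB).
assert (Hw' : Rabs (Cmod w) < 1) by (rewrite Rabs_pos_eq; [assumption | apply Cmod_ge_0]).
destruct (pow_lt_1_zero (Cmod w) Hw' (Cmod (x 0%nat) / B)) as [N HN].
{ now apply Rdiv_lt_0_compat. }
specialize (HN N (Nat.le_refl _)).
rewrite Rabs_pos_eq in HN by (apply pow_le, Cmod_ge_0).
assert (H : Cmod (x 0%nat) <= Cmod w ^ N * B).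
{ rewrite (Hpow N) at 1. rewrite Cmod_mult, Cmod_pow.
  apply Rmult_le_compat_l; [apply pow_le, Cmod_ge_0 | apply HB]. }
assert (Cmod w ^ N * B < Cmod (x 0%nat) / B * B) by now apply Rmult_lt_compat_r.
replace (Cmod (x 0%nat) / B * B) with (Cmod (x 0%nat)) in H0 by (field; lra).
lra.
Qed.

(** In one direction the recursion [kernel_moment_step] is a contraction, so
    boundedness forces the moments to vanish there; in the other direction it then
    computes them. Outside the disc the two directions are exchanged. *)
Lemma kernel_moment_inside : Cmod z < 1 -> forall k : nat,
  kernel_moment (Z.of_nat k) = (2 * PI * z ^ k)%C /\
  kernel_moment (- Z.of_nat (S k)) = 0.
Proof.
intros Hz1. destruct kernel_moment_bounded as [B HB].
assert (Hneg : forall k : nat, kernel_moment (- Z.of_nat (S k)) = 0).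
{ intros k.
  generalize (bounded_contraction_0 (fun j => kernel_moment (- Z.of_nat (S k) - Z.of_nat j)) z B Hz1).
  replace (- Z.of_nat (S k) - Z.of_nat 0)%Z with (- Z.of_nat (S k))%Z by lia.
  intros H. apply H; clear H.
  - intros j. apply HB.
  - intros j. rewrite kernel_moment_step, CInt_expk by lia.
    replace (- Z.of_nat (S k) - Z.of_nat j - 1)%Z with (- Z.of_nat (S k) - Z.of_nat (S j))%Z by lia.
    ring. }
intros k. split; [ | apply Hneg].
induction k as [|k IH].
- rewrite kernel_moment_step. change (Z.of_nat 0) with 0%Z. rewrite CInt_expk_0.
  change (0 - 1)%Z with (- Z.of_nat 1)%Z. rewrite Hneg, RtoC_mult. simpl. ring.
- rewrite kernel_moment_step, CInt_expk by lia.
  replace (Z.of_nat (S k) - 1)%Z with (Z.of_nat k) by lia. rewrite IH, Cpow_S. ring.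
Qed.

Lemma kernel_moment_outside : 1 < Cmod z -> forall k : nat,
  kernel_moment (Z.of_nat k) = 0 /\
  kernel_moment (- Z.of_nat (S k)) = (- (2 * PI) * / z ^ S k)%C.
Proof.
intros Hz1. destruct kernel_moment_bounded as [B HB].
assert (Hz0 : z <> RtoC 0) by (apply Cmod_gt_0; lra).
assert (Hinv : Cmod (/ z)%C < 1).
{ rewrite Cmod_inv by assumption. rewrite <- Rinv_1. apply Rinv_lt_contravar; lra. }
assert (Hback : forall n, kernel_moment (n - 1) =
  (/ z * (kernel_moment n - CInt (expk n) alpha (alpha + 2 * PI)))%C).
{ intros n. rewrite (kernel_moment_step n). field. assumption. }
assert (Hpos : forall k : nat, kernel_moment (Z.of_nat k) = 0).
{ intros k.
  generalize (bounded_contraction_0 (fun j => kernel_moment (Z.of_nat k + Z.of_nat j)) (/ z)%C B Hinv).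
  replace (Z.of_nat k + Z.of_nat 0)%Z with (Z.of_nat k) by lia.
  intros H. apply H; clear H.
  - intros j. apply HB.
  - intros j. replace (Z.of_nat k + Z.of_nat j)%Z with (Z.of_nat k + Z.of_nat (S j) - 1)%Z by lia.
    rewrite Hback, CInt_expk by lia. ring. }
intros k. split; [apply Hpos | ].
induction k as [|k IH].
- change (- Z.of_nat 1)%Z with (0 - 1)%Z. rewrite Hback, CInt_expk_0.
  rewrite (Hpos 0%nat : kernel_moment 0 = 0), Cpow_1_r, RtoC_mult. ring.
- replace (- Z.of_nat (S (S k)))%Z with (- Z.of_nat (S k) - 1)%Z by lia.
  rewrite Hback, CInt_expk, IH, (Cpow_S z (S k)) by lia.
  field. split; [now apply Cpow_nz | assumption].
Qed.

(** Integration by parts over a full period. *)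
Lemma CInt_expk_kernel2 n :
  CInt (fun x => expk n x * kernel2 (kernel z x))%C alpha (alpha + 2 * PI) =
  (- RtoC (IZR n ^ 2) * kernel_moment n)%C.
Proof.
set (w := (Ci * IZR n)%C).
assert (Hw : (- RtoC (IZR n ^ 2))%C = (w * w)%C).
{ unfold w, Ci, Cmult, Copp, RtoC; simpl. f_equal; ring. }
assert (Hc2 : forall x, Ccont (fun x => expk n x * kernel2 (kernel z x))%C x).
{ intros x. apply Ccont_mult; [apply Ccont_expk | apply Ccont_kernel2, Ccont_kernel]. }
assert (Hc1 : forall x, Ccont (fun x => - (w * w) * (expk n x * kernel z x))%C x).
{ intros x. apply Ccont_mult; [apply Ccont_const | apply Ccont_moment]. }
assert (H : (CInt (fun x => expk n x * kernel2 (kernel z x)) alpha (alpha + 2 * PI) +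
  - (w * w) * kernel_moment n)%C = 0).
{ unfold kernel_moment.
  rewrite <- (CInt_scal _ _ period_le) by (intros x _; apply Ccont_moment).
  rewrite <- (CInt_plus _ _ period_le); [ | intros x _; apply Hc2 | intros x _; apply Hc1].
  rewrite (CInt_FTC _ _ period_le
    (fun x => expk n x * kernel1 (kernel z x) + (- w) * (expk n x * kernel z x))%C).
  - rewrite expk_period, kernel_period. ring.
  - intros x _. assert (He : Cderiv (expk n) x (w * expk n x)%C) by apply (Cderiv_expi (IZR n)).
    eapply Cderiv_eq.
    + apply Cderiv_plus.
      * apply Cderiv_mult; [exact He | apply Cderiv_kernel1, kernel_denominator_neq_0].
      * apply Cderiv_mult; [apply Cderiv_const | ].
        apply Cderiv_mult; [exact He | apply Cderiv_kernel, kernel_denominator_neq_0].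
    + cbv beta. ring.
  - intros x _. apply Ccont_plus; [apply Hc2 | apply Hc1]. }
rewrite Hw.
transitivity ((CInt (fun x => expk n x * kernel2 (kernel z x)) alpha (alpha + 2 * PI) +
  - (w * w) * kernel_moment n) + w * w * kernel_moment n)%C; [ring | rewrite H; ring].
Qed.

Lemma Cmod_kernel2 : exists B, forall x, Cmod (kernel2 (kernel z x)) <= B.
Proof.
set (q := / Rabs (1 - Cmod z)).
exists (q + 3 * (q * q) + 2 * (q * q * q)). intros x.
generalize (Cmod_kernel x) (Cmod_ge_0 (kernel z x)). fold q.
unfold kernel2. set (u := kernel z x). intros Hu Hu0.
rewrite Cmod_opp.
eapply Rle_trans; [apply Cmod_triangle | ].
apply Rplus_le_compat; [eapply Rle_trans; [apply Cmod_triangle | ] | ].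
- rewrite Cmod_opp, !Cmod_mult, Cmod_R, Rabs_pos_eq by lra. nra.
- rewrite !Cmod_mult, Cmod_R, Rabs_pos_eq by lra.
  assert (Cmod u * Cmod u <= q * q) by nra. nra.
Qed.

Context (b : Z -> C) (A : R) (HA : forall n, Cmod (b n) <= A).

Lemma Ccont_density : forall x,
  Ccont (fun x => prim b x * kernel2 (kernel z x) + b 0%Z * kernel z x)%C x.
Proof.
intros x. apply Ccont_plus.
- apply Ccont_mult; [now apply Ccont_prim with A | apply Ccont_kernel2, Ccont_kernel].
- apply Ccont_mult; [apply Ccont_const | apply Ccont_kernel].
Qed.

(** The integral is the Cauchy transform of [sum_n b n e^{i n x}], with two
    derivatives moved from the distribution to the kernel so that the density is
    continuous. *)
Lemma cauchy_transform_series :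
  sums (two_sided (fun n => b n * kernel_moment n)%C)
    (CInt (fun x => prim b x * kernel2 (kernel z x) + b 0%Z * kernel z x)%C
       alpha (alpha + 2 * PI)).
Proof.
destruct Cmod_kernel2 as [B HB].
assert (HB0 : 0 <= B) by (apply Rle_trans with (2 := HB 0), Cmod_ge_0).
destruct (invsq_nonneg_series (2 * A * B)) as [Y HY].
{ generalize (Cmod_ge_0 (b 0%Z)) (HA 0%Z). intros. apply Rmult_le_pos; lra. }
assert (Hck : forall x, Ccont (fun x => kernel2 (kernel z x)) x).
{ intros x. apply Ccont_kernel2, Ccont_kernel. }
assert (Hcp : forall x, Ccont (fun x => prim b x * kernel2 (kernel z x))%C x).
{ intros x. apply Ccont_mult; [now apply Ccont_prim with A | apply Hck]. }
assert (Hcm : forall n x, Ccont (fun x => expk n x * kernel2 (kernel z x))%C x).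
{ intros n x. apply Ccont_mult; [apply Ccont_expk | apply Hck]. }
apply sums_incr.
assert (E0 : two_sided (fun n => b n * kernel_moment n)%C 0 =
  CInt (fun x => b 0%Z * kernel z x)%C alpha (alpha + 2 * PI)).
{ cbn [two_sided]. unfold kernel_moment.
  rewrite (CInt_scal _ _ period_le) by (intros x _; apply Ccont_kernel).
  f_equal. apply CInt_ext; [apply period_le | ]. intros x _. rewrite expk_0. ring. }
rewrite E0, (CInt_plus _ _ period_le); [ | intros x _; apply Hcp | intros x _;
  apply Ccont_mult; [apply Ccont_const | apply Ccont_kernel]].
match goal with |- sums _ ?X => replace X with
  (CInt (fun x => prim b x * kernel2 (kernel z x))%C alpha (alpha + 2 * PI)) by ring end.
apply (sums_ext (fun k => CInt (fun x => prim_term b k x * kernel2 (kernel z x))%C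
  alpha (alpha + 2 * PI))).
- intros k. cbn [two_sided].
  set (n := Z.of_nat (S k)).
  rewrite (CInt_ext _ _ period_le _ (fun x =>
    (- RtoC (invsq k) * b n) * (expk n x * kernel2 (kernel z x)) +
    (- RtoC (invsq k) * b (- n)%Z) * (expk (- n) x * kernel2 (kernel z x)))%C)
    by (intros x _; unfold prim_term; fold n; ring).
  rewrite (CInt_plus _ _ period_le) by
    (intros x _; apply Ccont_mult; [apply Ccont_const | apply Hcm]).
  rewrite !(CInt_scal _ _ period_le) by (intros x _; apply Hcm).
  rewrite !CInt_expk_kernel2, opp_IZR.
  replace ((- IZR n) ^ 2) with (IZR n ^ 2) by ring.
  transitivity ((RtoC (invsq k) * RtoC (IZR n ^ 2)) *
    (b n * kernel_moment n + b (- n)%Z * kernel_moment (- n)))%C; [ring | ].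
  unfold n. rewrite invsq_inv. ring.
- apply (CInt_sums _ _ period_le (fun k x => prim_term b k x * kernel2 (kernel z x))%C
    (fun x => prim b x * kernel2 (kernel z x))%C _ _ HY).
  + intros k x _. apply Ccont_mult; [apply Ccont_prim_term | apply Hck].
  + intros x _. apply Hcp.
  + intros k x _. rewrite Cmod_mult.
    replace (2 * A * B * invsq k) with (2 * A * invsq k * B) by ring.
    apply Rmult_le_compat; [apply Cmod_ge_0 | apply Cmod_ge_0 | now apply Cmod_prim_term | apply HB].
  + intros x _. apply (sums_ext (fun k => kernel2 (kernel z x) * prim_term b k x)%C);
      [intros k; ring | ].
    rewrite Cmult_comm. apply sums_scal. now apply prim_sums with A.
Qed.

End Moments.

(** * Holomorphic dependence on a parameter *)

Lemma quadratic_is_derive (g : C -> C) w l B delta : 0 < delta ->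
  (forall eta, Cmod eta < delta ->
    Cmod (g (w + eta) - g w - eta * l)%C <= B * Cmod eta ^ 2) ->
  is_derive (K := C_AbsRing) (V := C_NormedModule) g w l.
Proof.
intros Hdelta Hq. split.
- apply (is_linear_scal_l (K := C_AbsRing) (V := C_NormedModule)).
- intros x Hx. apply (is_filter_lim_locally_unique (K := C_AbsRing)
    (V := AbsRing_NormedModule C_AbsRing)) in Hx. subst x.
  intros eps.
  assert (HB : 0 < Rabs B + 1) by (generalize (Rabs_pos B); lra).
  assert (Hd : 0 < Rmin delta (eps / (Rabs B + 1))).
  { apply Rmin_glb_lt; [assumption | apply Rdiv_lt_0_compat; [apply cond_pos | assumption]]. }
  exists (mkposreal _ Hd). intros y Hy.
  change (Cmod (y - w)%C < Rmin delta (eps / (Rabs B + 1))) in Hy.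
  change (Cmod (g y - g w - (y - w) * l)%C <= eps * Cmod (y - w)%C).
  set (eta := (y - w)%C) in *.
  replace y with (w + eta)%C by (unfold eta; ring).
  assert (H1 : Cmod eta < delta) by (apply Rlt_le_trans with (1 := Hy), Rmin_l).
  assert (H2 : Cmod eta <= eps / (Rabs B + 1)).
  { left. apply Rlt_le_trans with (1 := Hy), Rmin_r. }
  eapply Rle_trans; [now apply Hq | ].
  generalize (Cmod_ge_0 eta). intros H0.
  replace (B * Cmod eta ^ 2) with ((B * Cmod eta) * Cmod eta) by ring.
  apply Rmult_le_compat_r; [assumption | ].
  apply Rle_trans with ((Rabs B + 1) * Cmod eta).
  + apply Rmult_le_compat_r; [assumption | ]. generalize (Rle_abs B). lra.
  + apply Rmult_le_compat_l with (r := Rabs B + 1) in H2; [ | lra].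
    replace ((Rabs B + 1) * (eps / (Rabs B + 1))) with (pos eps) in H2 by (field; lra).
    exact H2.
Qed.

Lemma holomorphic_at_intro (g : C -> C) z eps : 0 < eps ->
  (forall w, Cmod (w - z)%C < eps -> ex_derive (K := C_AbsRing) (V := C_NormedModule) g w) ->
  holomorphic_at g z.
Proof.
intros Heps H.
assert (He : 0 < eps / 2) by lra.
exists (mkposreal _ He). intros w Hw. apply H.
apply Rlt_le_trans with (1 := C_NormedModule_mixin_compat2 z w (mkposreal _ He) Hw).
simpl. assert (sqrt 2 <= 2).
{ rewrite <- (sqrt_Rsqr 2) at 2 by lra. apply sqrt_le_1; unfold Rsqr; lra. }
nra.
Qed.

Section Families.

Context (l r : R) (Hlr : l <= r).

(** [k'] is the [w]-derivative of [k], with a quadratic remainder uniform in the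
    real variable; unlike bare differentiability, this passes under the integral. *)
Definition smooth_family (k : C -> R -> C) (w : C) (k' : R -> C) : Prop :=
  exists B delta, 0 <= B /\ 0 < delta <= 1 /\
  (forall eta, Cmod eta < delta -> Ccont_on l r (k (w + eta)%C)) /\ Ccont_on l r k' /\
  forall x, l <= x <= r -> Cmod (k w x) <= B /\ Cmod (k' x) <= B /\
    forall eta, Cmod eta < delta ->
      Cmod (k (w + eta)%C x - k w x - eta * k' x)%C <= B * Cmod eta ^ 2.

Lemma smooth_const (f : R -> C) w B :
  Ccont_on l r f -> (forall x, l <= x <= r -> Cmod (f x) <= B) ->
  smooth_family (fun _ => f) w (fun _ => 0).
Proof.
intros Hf HB.
assert (HB0 : 0 <= B) by (apply Rle_trans with (2 := HB l ltac:(lra)), Cmod_ge_0).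
exists B, 1. split; [lra | ]. split; [lra | ]. split; [ | split].
- intros eta _. exact Hf.
- intros t _. apply Ccont_const.
- intros x Hx. split; [now apply HB | ]. split; [now rewrite Cmod_0 | ].
  intros eta _. replace (f x - f x - eta * 0)%C with (RtoC 0) by ring.
  rewrite Cmod_0. apply Rmult_le_pos; [assumption | apply pow2_ge_0].
Qed.

Lemma smooth_plus k m w k' m' : smooth_family k w k' -> smooth_family m w m' ->
  smooth_family (fun w x => k w x + m w x)%C w (fun x => k' x + m' x)%C.
Proof.
intros (B1 & d1 & HB1 & Hd1 & Hc1 & Hc1' & H1) (B2 & d2 & HB2 & Hd2 & Hc2 & Hc2' & H2).
exists (B1 + B2), (Rmin d1 d2).
split; [lra | ]. split; [split; [now apply Rmin_glb_lt | ] | ].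
{ apply Rle_trans with (1 := Rmin_l _ _). lra. }
split; [ | split].
- intros eta Heta x Hx. apply Ccont_plus; [apply Hc1 | apply Hc2]; try assumption.
  + apply Rlt_le_trans with (1 := Heta), Rmin_l.
  + apply Rlt_le_trans with (1 := Heta), Rmin_r.
- intros x Hx. apply Ccont_plus; [now apply Hc1' | now apply Hc2'].
- intros x Hx. destruct (H1 x Hx) as (P1 & P2 & P3). destruct (H2 x Hx) as (Q1 & Q2 & Q3).
  split; [ | split].
  + eapply Rle_trans; [apply Cmod_triangle | lra].
  + eapply Rle_trans; [apply Cmod_triangle | lra].
  + intros eta Heta.
    specialize (P3 eta (Rlt_le_trans _ _ _ Heta (Rmin_l _ _))).
    specialize (Q3 eta (Rlt_le_trans _ _ _ Heta (Rmin_r _ _))).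
    replace (k (w + eta) x + m (w + eta) x - (k w x + m w x) - eta * (k' x + m' x))%C
      with ((k (w + eta) x - k w x - eta * k' x) + (m (w + eta) x - m w x - eta * m' x))%C by ring.
    eapply Rle_trans; [apply Cmod_triangle | lra].
Qed.

Lemma smooth_mult k m w k' m' : smooth_family k w k' -> smooth_family m w m' ->
  smooth_family (fun w x => k w x * m w x)%C w (fun x => k' x * m w x + k w x * m' x)%C.
Proof.
intros (B1 & d1 & HB1 & Hd1 & Hc1 & Hc1' & H1) (B2 & d2 & HB2 & Hd2 & Hc2 & Hc2' & H2).
assert (HBB : 0 <= B1 * B2) by now apply Rmult_le_pos.
assert (Hz : forall f : C -> R -> C, f (w + 0)%C = f w) by (intros f; f_equal; ring).
exists (6 * (B1 * B2)), (Rmin d1 d2).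
split; [lra | ]. split; [split; [now apply Rmin_glb_lt | ] | ].
{ apply Rle_trans with (1 := Rmin_l _ _). lra. }
split; [ | split].
- intros eta Heta x Hx. apply Ccont_mult; [apply Hc1 | apply Hc2]; try assumption.
  + apply Rlt_le_trans with (1 := Heta), Rmin_l.
  + apply Rlt_le_trans with (1 := Heta), Rmin_r.
- assert (Hc1w : Ccont_on l r (k w)).
  { rewrite <- (Hz k). apply Hc1. rewrite Cmod_0. lra. }
  assert (Hc2w : Ccont_on l r (m w)).
  { rewrite <- (Hz m). apply Hc2. rewrite Cmod_0. lra. }
  intros x Hx. apply Ccont_plus; apply Ccont_mult; auto.
- intros x Hx. destruct (H1 x Hx) as (P1 & P2 & P3). destruct (H2 x Hx) as (Q1 & Q2 & Q3).
  assert (Mul : forall p q b1 b2, Cmod p <= b1 -> Cmod q <= b2 -> Cmod (p * q)%C <= b1 * b2).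
  { intros p q b1 b2 Hp Hq. rewrite Cmod_mult.
    apply Rmult_le_compat; try assumption; apply Cmod_ge_0. }
  split; [ | split].
  + apply Rle_trans with (B1 * B2); [now apply Mul | lra].
  + eapply Rle_trans; [apply Cmod_triangle | ].
    generalize (Mul _ _ _ _ P2 Q1) (Mul _ _ _ _ P1 Q2). lra.
  + intros eta Heta.
    assert (He : Cmod eta <= 1).
    { generalize (Rlt_le_trans _ _ _ Heta (Rmin_l _ _)). lra. }
    generalize (Cmod_ge_0 eta). intros He0.
    specialize (P3 eta (Rlt_le_trans _ _ _ Heta (Rmin_l _ _))).
    specialize (Q3 eta (Rlt_le_trans _ _ _ Heta (Rmin_r _ _))).
    set (p := (k (w + eta) x - k w x - eta * k' x)%C) in *.
    set (q := (m (w + eta) x - m w x - eta * m' x)%C) in *.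
    replace (k (w + eta) x)%C with (k w x + eta * k' x + p)%C by (unfold p; ring).
    replace (m (w + eta) x)%C with (m w x + eta * m' x + q)%C by (unfold q; ring).
    replace ((k w x + eta * k' x + p) * (m w x + eta * m' x + q) - k w x * m w x
        - eta * (k' x * m w x + k w x * m' x))%C
      with (eta * eta * (k' x * m' x) + p * (m w x + eta * m' x + q)
        + (k w x + eta * k' x) * q)%C by ring.
    set (e := Cmod eta) in *.
    assert (He2 : 0 <= e ^ 2 <= 1) by nra.
    assert (Hek : Cmod (eta * k' x)%C <= 1 * B1) by (apply Mul; [exact He | exact P2]).
    assert (Hem : Cmod (eta * m' x)%C <= 1 * B2) by (apply Mul; [exact He | exact Q2]).
    assert (Hq1 : Cmod q <= B2) by nra.
    assert (T1 : Cmod (eta * eta * (k' x * m' x))%C <= (e * e) * (B1 * B2)).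
    { apply Mul; [apply Mul; right; reflexivity | now apply Mul]. }
    assert (T2 : Cmod (p * (m w x + eta * m' x + q))%C <= (B1 * e ^ 2) * (3 * B2)).
    { apply Mul; [exact P3 | ].
      eapply Rle_trans; [apply Cmod_triangle | ].
      generalize (Cmod_triangle (m w x) (eta * m' x)%C). lra. }
    assert (T3 : Cmod ((k w x + eta * k' x) * q)%C <= (2 * B1) * (B2 * e ^ 2)).
    { apply Mul; [ | exact Q3].
      eapply Rle_trans; [apply Cmod_triangle | ]. lra. }
    eapply Rle_trans; [apply Cmod_triangle | ].
    eapply Rle_trans; [apply Rplus_le_compat_r, Cmod_triangle | ].
    replace (6 * (B1 * B2) * e ^ 2) with
      ((e * e) * (B1 * B2) + (B1 * e ^ 2) * (3 * B2) + (2 * B1) * (B2 * e ^ 2)) by ring.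
    lra.
Qed.

(** The second-order remainder of [w -> 1 / (1 - e w)] is explicit. *)
Lemma smooth_resolvent (e : R -> C) w d : 0 < d <= 1 ->
  Ccont_on l r e -> (forall x, Cmod (e x) = 1) ->
  (forall x, l <= x <= r -> d <= Cmod (1 - e x * w)%C) ->
  smooth_family (fun w x => / (1 - e x * w))%C w
    (fun x => e x * (/ (1 - e x * w) * / (1 - e x * w)))%C.
Proof.
intros Hd He He1 Hdist.
assert (Hnear : forall eta x, l <= x <= r -> Cmod eta < d / 2 ->
  d / 2 <= Cmod (1 - e x * (w + eta))%C).
{ intros eta x Hx Heta.
  generalize (Cmod_sub_le (1 - e x * w)%C (1 - e x * (w + eta))%C) (Hdist x Hx).
  replace (1 - e x * w - (1 - e x * (w + eta)))%C with (e x * eta)%C by ring.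
  rewrite Cmod_mult, He1. lra. }
assert (Hnz : forall x, l <= x <= r -> (1 - e x * w)%C <> RtoC 0).
{ intros x Hx. apply Cmod_gt_0. generalize (Hdist x Hx). lra. }
assert (Hnz' : forall eta x, l <= x <= r -> Cmod eta < d / 2 ->
  (1 - e x * (w + eta))%C <> RtoC 0).
{ intros eta x Hx Heta. apply Cmod_gt_0. generalize (Hnear eta x Hx Heta). lra. }
assert (Hcont : forall v x, l <= x <= r -> Ccont (fun x => 1 - e x * v)%C x).
{ intros v x Hx. apply Ccont_plus; [apply Ccont_const | ]. apply Ccont_opp.
  apply Ccont_mult; [now apply He | apply Ccont_const]. }
set (i := / d).
assert (Hi : 1 <= i) by (unfold i; rewrite <- Rinv_1 at 1; apply Rinv_le_contravar; lra).
assert (Hinv : forall x, l <= x <= r -> Cmod (/ (1 - e x * w))%C <= i).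
{ intros x Hx. rewrite Cmod_inv by now apply Hnz. apply Rinv_le_contravar; [lra | now apply Hdist]. }
assert (Hi2 : i * i <= 2 * (i * i * i)) by nra.
exists (2 * (i * i * i)), (d / 2).
split; [nra | ]. split; [lra | ]. split; [ | split].
- intros eta Heta x Hx. apply Ccont_inv; [now apply Hnz' | now apply Hcont].
- intros x Hx. apply Ccont_mult; [now apply He | ].
  apply Ccont_mult; apply Ccont_inv; now (apply Hnz || apply Hcont).
- intros x Hx. split; [ | split].
  + apply Rle_trans with i; [now apply Hinv | nra].
  + rewrite !Cmod_mult, He1, Rmult_1_l.
    generalize (Hinv x Hx) (Cmod_ge_0 (/ (1 - e x * w))%C). nra.
  + intros eta Heta.
    replace (/ (1 - e x * (w + eta)) - / (1 - e x * w)
        - eta * (e x * (/ (1 - e x * w) * / (1 - e x * w))))%C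
      with ((eta * eta) * ((e x * e x) *
        ((/ (1 - e x * w) * / (1 - e x * w)) * / (1 - e x * (w + eta)))))%C
      by (field; split; [now apply Hnz | now apply Hnz']).
    rewrite !Cmod_mult, He1.
    assert (H1 : Cmod (/ (1 - e x * (w + eta)))%C <= 2 * i).
    { rewrite Cmod_inv by now apply Hnz'.
      replace (2 * i) with (/ (d / 2)) by (unfold i; field; lra).
      apply Rinv_le_contravar; [lra | now apply Hnear]. }
    generalize (Hinv x Hx) (Cmod_ge_0 (/ (1 - e x * w))%C) (Cmod_ge_0 (/ (1 - e x * (w + eta)))%C).
    set (P := Cmod (/ (1 - e x * w))%C). set (Q := Cmod (/ (1 - e x * (w + eta)))%C) in *.
    intros H2 H3 H4.
    replace (2 * (i * i * i) * Cmod eta ^ 2) with (Cmod eta * Cmod eta * (i * i * (2 * i))) by ring.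
    replace (1 * 1 * (P * P * Q)) with (P * P * Q) by ring.
    apply Rmult_le_compat_l; [apply Rmult_le_pos; apply Cmod_ge_0 | ].
    apply Rmult_le_compat; [now apply Rmult_le_pos | assumption | nra | assumption].
Qed.

Lemma smooth_ext k m w k' : (forall v x, k v x = m v x) ->
  smooth_family k w k' -> smooth_family m w k'.
Proof.
intros E (B & d & HB & Hd & Hc & Hc' & H).
exists B, d. split; [assumption | ]. split; [assumption | ]. split; [ | split; [assumption | ]].
- intros eta Heta x Hx. apply (Ccont_ext (k (w + eta)%C)); [apply E | now apply Hc].
- intros x Hx. destruct (H x Hx) as (P1 & P2 & P3). rewrite <- E. split; [assumption | ].
  split; [assumption | ]. intros eta Heta. rewrite <- !E. now apply P3.
Qed.

Lemma smooth_CInt k w k' : smooth_family k w k' ->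
  is_derive (K := C_AbsRing) (V := C_NormedModule) (fun w => CInt (k w) l r) w (CInt k' l r).
Proof.
intros (B & d & HB & Hd & Hc & Hc' & H).
assert (Hcw : Ccont_on l r (k w)).
{ replace w with (w + 0)%C by ring. apply Hc. rewrite Cmod_0. lra. }
apply (quadratic_is_derive _ _ _ (2 * ((r - l) * B)) d); [lra | ].
intros eta Heta.
assert (H1 : Ccont_on l r (fun x => - k w x)%C) by (intros x Hx; now apply Ccont_opp, Hcw).
assert (H2 : Ccont_on l r (fun x => (- eta) * k' x)%C).
{ intros x Hx. apply Ccont_mult; [apply Ccont_const | now apply Hc']. }
assert (H3 : Ccont_on l r (fun x => k (w + eta)%C x + - k w x)%C).
{ intros x Hx. apply Ccont_plus; [now apply Hc | now apply H1]. }
replace (CInt (k (w + eta)%C) l r - CInt (k w) l r - eta * CInt k' l r)%C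
  with (CInt (fun x => k (w + eta)%C x + - k w x + (- eta) * k' x)%C l r).
- replace (2 * ((r - l) * B) * Cmod eta ^ 2) with (2 * ((r - l) * (B * Cmod eta ^ 2))) by ring.
  apply CInt_Cmod_le_const; [assumption | | ].
  + intros x Hx. apply Ccont_plus; [now apply H3 | now apply H2].
  + intros x Hx. replace (k (w + eta) x + - k w x + - eta * k' x)%C
      with (k (w + eta) x - k w x - eta * k' x)%C by ring.
    now apply (H x Hx).
- rewrite (CInt_plus l r Hlr _ _ H3 H2), (CInt_plus l r Hlr _ _ (Hc eta Heta) H1).
  rewrite (CInt_opp l r Hlr _ Hcw), (CInt_scal l r Hlr _ _ Hc'). ring.
Qed.

Lemma smooth_eval k w k' x : l <= x <= r -> smooth_family k w k' ->
  is_derive (K := C_AbsRing) (V := C_NormedModule) (fun w => k w x) w (k' x).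
Proof.
intros Hx (B & d & HB & Hd & Hc & Hc' & H).
apply (quadratic_is_derive _ _ _ B d); [lra | ]. apply (H x Hx).
Qed.

Lemma smooth_kernel1 k w k' : smooth_family k w k' ->
  exists m, smooth_family (fun w x => kernel1 (k w x)) w m.
Proof.
intros H.
assert (Hcst : forall c, smooth_family (fun _ _ => c) w (fun _ => 0)).
{ intros c. apply (smooth_const _ _ (Cmod c)); [intros x _; apply Ccont_const | intros; lra]. }
eexists. apply smooth_mult; [apply Hcst | ].
apply smooth_plus; [exact H | ].
apply (smooth_ext (fun w x => (- (1)) * (k w x * k w x))%C); [intros; ring | ].
apply smooth_mult; [apply Hcst | ]. apply smooth_mult; exact H.
Qed.

Lemma smooth_kernel2 k w k' : smooth_family k w k' ->
  exists m, smooth_family (fun w x => kernel2 (k w x)) w m.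
Proof.
intros H.
assert (Hcst : forall c, smooth_family (fun _ _ => c) w (fun _ => 0)).
{ intros c. apply (smooth_const _ _ (Cmod c)); [intros x _; apply Ccont_const | intros; lra]. }
eexists.
apply (smooth_ext (fun w x => (- (1)) * k w x + (3 * (k w x * k w x)
  + - (2) * (k w x * (k w x * k w x))))%C); [intros; unfold kernel2; ring | ].
apply smooth_plus; [apply smooth_mult; [apply Hcst | exact H] | ].
apply smooth_plus; (apply smooth_mult; [apply Hcst | ]).
- apply smooth_mult; exact H.
- apply smooth_mult; [exact H | apply smooth_mult; exact H].
Qed.

End Families.

(** * Continuation across the arc *)

Section Continuation.

Context (b : Z -> C) (A : R) (HA : forall n, Cmod (b n) <= A).
Context (alpha beta : R) (Hab : alpha < beta <= alpha + 2 * PI).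
Context (c d : C) (Hprim : forall x, alpha <= x <= beta ->
  prim b x = (c * x + d - b 0%Z * (RtoC x * RtoC x) / 2)%C).

Let gamma := alpha + 2 * PI.
Let q (x : R) : C := (c * x + d - b 0%Z * (RtoC x * RtoC x) / 2)%C.
Let q1 (x : R) : C := (c - b 0%Z * x)%C.
Let norm_cst : C := RtoC (/ (2 * PI)).

(** The Cauchy transform of the distribution [sum_n b n e^{i n x}], with the
    integral over the arc replaced by its boundary terms; they are taken at
    [beta] and [gamma], which stands for [alpha] by periodicity. *)
Definition continuation_of (k : R -> C) : C :=
  (CInt (fun x => norm_cst * (prim b x * kernel2 (k x) + b 0%Z * k x)) beta gamma
   + norm_cst * ((q beta * kernel1 (k beta) + - q1 beta * k beta)
                 + (- q alpha * kernel1 (k gamma) + q1 alpha * k gamma)))%C.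

(** At infinity the value 0 is the limit of the kernel. *)
Definition sphere_kernel (p : Csphere) (x : R) : C :=
  match p with
  | Cfin z => kernel z x
  | Cinf => 0
  end.

Definition continuation (p : Csphere) : C := continuation_of (sphere_kernel p).

Lemma beta_le_gamma : beta <= gamma.
Proof. unfold gamma. lra. Qed.

Lemma continuation_of_ext k k' :
  (forall x, beta <= x <= gamma -> k x = k' x) -> continuation_of k = continuation_of k'.
Proof.
intros E. unfold continuation_of. generalize beta_le_gamma. intros H.
rewrite (E beta), (E gamma) by lra. f_equal.
apply CInt_ext; [assumption | ]. intros x Hx. now rewrite E.
Qed.

(** Over the arc the second primitive is [q], whose second derivative is [- b 0], so
    the density [q u'' + b 0 u] is the derivative of [q u' - q' u]. *)
Lemma continuation_off_circle z : Cmod z <> 1 ->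
  continuation (Cfin z) = (norm_cst *
    CInt (fun x => prim b x * kernel2 (kernel z x) + b 0%Z * kernel z x)%C alpha gamma)%C.
Proof.
intros Hz. unfold continuation, continuation_of. cbn [sphere_kernel].
assert (Hc := Ccont_density z Hz b A HA).
rewrite (CInt_Chasles _ alpha beta gamma) by
  solve [generalize beta_le_gamma; lra | intros x _; apply Hc].
rewrite CInt_scal by solve [apply beta_le_gamma | intros x _; apply Hc].
assert (Hq : forall x, Cderiv q x (q1 x)).
{ intros x.
  apply (Cderiv_ext (fun x => c * RtoC x + (d + (- (b 0%Z / 2)) * (RtoC x * RtoC x)))%C).
  - intros t. unfold q. field.
  - eapply Cderiv_eq.
    + apply Cderiv_plus; [apply Cderiv_mult; [apply Cderiv_const | apply Cderiv_id] | ].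
      apply Cderiv_plus; [apply Cderiv_const | ].
      apply Cderiv_mult; [apply Cderiv_const | apply Cderiv_mult; apply Cderiv_id].
    + unfold q1. field. }
assert (Hq1 : forall x, Cderiv q1 x (- b 0%Z)%C).
{ intros x. apply (Cderiv_ext (fun x => c + (- b 0%Z) * RtoC x)%C).
  - intros t. unfold q1. ring.
  - eapply Cderiv_eq.
    + apply Cderiv_plus; [apply Cderiv_const | ].
      apply Cderiv_mult; [apply Cderiv_const | apply Cderiv_id].
    + cbv beta. ring. }
rewrite (CInt_ext alpha beta ltac:(lra) _
  (fun x => q x * kernel2 (kernel z x) + b 0%Z * kernel z x)%C).
2: { intros x Hx. now rewrite Hprim. }
assert (Hcq : forall x, Ccont q x) by (intros x; eapply Cderiv_cont, Hq).
rewrite (CInt_FTC alpha beta ltac:(lra)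
  (fun x => q x * kernel1 (kernel z x) + (- (1)) * (q1 x * kernel z x))%C).
- replace (kernel z gamma) with (kernel z alpha) by (symmetry; apply kernel_period). ring.
- intros x _. eapply Cderiv_eq.
  + apply Cderiv_plus.
    * apply Cderiv_mult; [apply Hq | apply Cderiv_kernel1, (kernel_denominator_neq_0 z Hz)].
    * apply Cderiv_mult; [apply Cderiv_const | ].
      apply Cderiv_mult; [apply Hq1 | apply Cderiv_kernel, (kernel_denominator_neq_0 z Hz)].
  + cbv beta. ring.
- intros x _. apply Ccont_plus.
  + apply Ccont_mult; [apply Hcq | apply Ccont_kernel2, (Ccont_kernel z Hz)].
  + apply Ccont_mult; [apply Ccont_const | apply (Ccont_kernel z Hz)].
Qed.

Lemma norm_cst_2PI : (norm_cst * (2 * PI))%C = 1.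
Proof.
unfold norm_cst. rewrite <- !RtoC_mult. f_equal. field. apply PI_neq0.
Qed.

Lemma continuation_inside z : Cmod z < 1 -> continuation (Cfin z) = f_plus b z.
Proof.
intros Hz. assert (Hz1 : Cmod z <> 1) by lra.
rewrite continuation_off_circle by assumption.
assert (H := sums_scal norm_cst _ _ (cauchy_transform_series alpha z Hz1 b A HA)).
symmetry. apply CSeries_eq. revert H. apply sums_ext.
intros k. destruct (kernel_moment_inside alpha z Hz1 Hz k) as [H1 _].
assert (E : forall u : C, (norm_cst * (u * (2 * PI * z ^ k)))%C = (u * z ^ k)%C).
{ intros u. transitivity ((norm_cst * (2 * PI)) * (u * z ^ k))%C; [ring | ].
  rewrite norm_cst_2PI. ring. }
destruct k as [|k].
- cbn [two_sided]. change 0%Z with (Z.of_nat 0). rewrite H1. apply E.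
- cbn [two_sided]. rewrite H1.
  destruct (kernel_moment_inside alpha z Hz1 Hz k) as [_ ->].
  rewrite Cmult_0_r, Cplus_0_r. apply E.
Qed.

Lemma continuation_outside z : 1 < Cmod z ->
  (continuation (Cfin z) + f_minus b (Cfin z))%C = 0.
Proof.
intros Hz. assert (Hz1 : Cmod z <> 1) by lra.
assert (H := sums_scal norm_cst _ _ (cauchy_transform_series alpha z Hz1 b A HA)).
rewrite <- continuation_off_circle in H by assumption.
assert (Hm : f_minus b (Cfin z) = (- (1) * continuation (Cfin z))%C).
{ cbn [f_minus]. apply CSeries_eq.
  apply sums_incr in H.
  assert (H0 : two_sided (fun n => b n * kernel_moment alpha z n)%C 0 = 0).
  { cbn [two_sided]. change 0%Z with (Z.of_nat 0).
    destruct (kernel_moment_outside alpha z Hz1 Hz 0) as [-> _]. ring. }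
  rewrite H0 in H.
  replace (continuation (Cfin z) - norm_cst * 0)%C with (continuation (Cfin z)) in H by ring.
  apply (sums_scal (- (1))%C) in H. revert H. apply sums_ext.
  intros k. cbn [two_sided].
  destruct (kernel_moment_outside alpha z Hz1 Hz (S k)) as [-> _].
  destruct (kernel_moment_outside alpha z Hz1 Hz k) as [_ ->].
  transitivity ((norm_cst * (2 * PI)) * (b (- Z.of_nat (S k))%Z * / z ^ S k))%C; [ring | ].
  rewrite norm_cst_2PI. ring. }
rewrite Hm. ring.
Qed.

Lemma continuation_inf : continuation Cinf = 0.
Proof.
unfold continuation, continuation_of. cbn [sphere_kernel].
rewrite (CInt_ext beta gamma beta_le_gamma _ (fun _ => 0 * 0)%C).
- rewrite (CInt_scal beta gamma beta_le_gamma 0 (fun _ => RtoC 0)) by (intros x _; apply Ccont_const).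
  unfold kernel1. ring.
- intros x _. unfold kernel2. ring.
Qed.

Lemma continuation_of_derivable k w k' : smooth_family beta gamma k w k' ->
  ex_derive (K := C_AbsRing) (V := C_NormedModule) (fun w => continuation_of (k w)) w.
Proof.
intros Hk. generalize beta_le_gamma. intros Hbg.
assert (Hcst : forall u, smooth_family beta gamma (fun _ _ => u) w (fun _ => 0)).
{ intros u. apply (smooth_const beta gamma Hbg _ _ (Cmod u));
    [intros x _; apply Ccont_const | intros; lra]. }
destruct (smooth_kernel1 _ _ Hbg k w k' Hk) as [k1 Hk1].
destruct (smooth_kernel2 _ _ Hbg k w k' Hk) as [k2 Hk2].
destruct (prim_bounded b A HA) as [B HB].
assert (Hp : smooth_family beta gamma (fun _ => prim b) w (fun _ => 0)).
{ apply (smooth_const beta gamma Hbg _ _ B); [intros x _; now apply Ccont_prim with A | auto]. }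
assert (Hedge : forall u v, exists m, smooth_family beta gamma
  (fun w x => norm_cst * (u * kernel1 (k w x) + v * k w x))%C w m).
{ intros u v. eexists. apply smooth_mult; [apply Hcst | ].
  apply smooth_plus; (apply smooth_mult; [apply Hcst | ]); [exact Hk1 | exact Hk]. }
destruct (Hedge (q beta) (- q1 beta)%C) as [m1 Hm1].
destruct (Hedge (- q alpha)%C (q1 alpha)) as [m2 Hm2].
apply (ex_derive_ext (K := C_AbsRing) (V := C_NormedModule) (fun w =>
  plus (CInt (fun x => norm_cst * (prim b x * kernel2 (k w x) + b 0%Z * k w x))%C beta gamma)
    (plus (norm_cst * (q beta * kernel1 (k w beta) + - q1 beta * k w beta))%C
          (norm_cst * (- q alpha * kernel1 (k w gamma) + q1 alpha * k w gamma))%C))).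
- intros v. unfold continuation_of. change plus with Cplus. simpl. ring.
- apply (ex_derive_plus (K := C_AbsRing) (V := C_NormedModule));
    [ | apply (ex_derive_plus (K := C_AbsRing) (V := C_NormedModule))].
  + eexists. apply (smooth_CInt beta gamma Hbg
      (fun w x => norm_cst * (prim b x * kernel2 (k w x) + b 0%Z * k w x))%C).
    apply smooth_mult; [apply Hcst | ].
    apply smooth_plus; apply smooth_mult; [exact Hp | exact Hk2 | apply Hcst | exact Hk].
  + eexists. apply (smooth_eval beta gamma _ _ _ beta ltac:(lra) Hm1).
  + eexists. apply (smooth_eval beta gamma _ _ _ gamma ltac:(lra) Hm2).
Qed.

Lemma Ccont_expi_opp x : Ccont (fun t => expi (- t)) x.
Proof. eapply Cderiv_cont, Cderiv_expi_opp. Qed.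

(** By compactness it is enough that [z] is not on the closed complementary arc:
    a point of the open arc has no second angle in [[beta, gamma]]. *)
Lemma slit_distance z : slit_sphere (open_arc alpha beta) (Cfin z) ->
  exists e, 0 < e <= 1 /\
  forall x, beta <= x <= gamma -> e <= Cmod (1 - expi (- x) * z)%C.
Proof.
intros Hz. cbn [slit_sphere] in Hz.
assert (Hinv : forall x, (expi (- x) * expi x)%C = 1).
{ intros x. now rewrite <- expi_plus, Rplus_opp_l, expi_0. }
assert (Hne : forall x, beta <= x <= gamma -> 0 < Cmod (1 - expi (- x) * z)%C).
{ intros x Hx. apply Cmod_gt_0. intros E0.
  assert (Ez : z = expi x).
  { transitivity (expi x * (expi (- x) * z))%C.
    - rewrite Cmult_assoc, (Cmult_comm (expi x)), Hinv. ring.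
    - replace (expi (- x) * z)%C with (1 - (1 - expi (- x) * z))%C by ring.
      rewrite E0. ring. }
  apply Hz. split; [rewrite Ez; apply Cmod_expi | ]. intros (t & Ht & Et).
  assert (E1 : expi (x - t) = 1).
  { unfold Rminus. rewrite expi_plus, <- Ez, Et, Cmult_comm. apply Hinv. }
  assert (Hcos : cos (x - t) = 1) by exact (f_equal fst E1).
  assert (Hs : 0 < sin ((x - t) / 2)) by (apply sin_gt_0; unfold gamma in Hx; lra).
  replace (x - t) with (2 * ((x - t) / 2)) in Hcos by field.
  rewrite cos_2a_sin in Hcos. nra. }
destruct (continuity_ab_min (fun x => Cmod (1 - expi (- x) * z)%C) beta gamma beta_le_gamma)
  as (m & Hm & Hmx).
{ intros x _. apply continuity_pt_filterlim.
  apply (Ccont_Cmod (fun x => 1 - expi (- x) * z)%C).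
  apply Ccont_plus; [apply Ccont_const | ]. apply Ccont_opp.
  apply Ccont_mult; [apply Ccont_expi_opp | apply Ccont_const]. }
exists (Rmin (Cmod (1 - expi (- m) * z)%C) 1). split.
- split; [apply Rmin_glb_lt; [now apply Hne | lra] | apply Rmin_r].
- intros x Hx. apply Rle_trans with (1 := Rmin_l _ _). now apply Hm.
Qed.

Lemma continuation_analytic_fin z : slit_sphere (open_arc alpha beta) (Cfin z) ->
  analytic_at continuation (Cfin z).
Proof.
intros Hz. destruct (slit_distance z Hz) as (e & He & Hdist).
apply (holomorphic_at_intro _ _ (e / 2)); [lra | ]. intros w Hw.
eapply (continuation_of_derivable kernel).
unfold kernel. apply (smooth_resolvent beta gamma (fun x => expi (- x)) w (e / 2)).
- lra.
- intros x _. apply Ccont_expi_opp.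
- intros x. apply Cmod_expi.
- intros x Hx.
  generalize (Cmod_sub_le (1 - expi (- x) * z)%C (1 - expi (- x) * w)%C) (Hdist x Hx).
  replace (1 - expi (- x) * z - (1 - expi (- x) * w))%C with (expi (- x) * (w - z))%C by ring.
  rewrite Cmod_mult, Cmod_expi. lra.
Qed.

(** In the chart [w = 1 / z] the kernel is [1 - 1 / (1 - zeta w)]. *)
Lemma continuation_analytic_inf : analytic_at continuation Cinf.
Proof.
assert (Hdist : forall w x, Cmod w < / 2 -> / 2 <= Cmod (1 - expi x * w)%C).
{ intros w x Hw. generalize (Cmod_sub_le 1 (1 - expi x * w)%C).
  replace (1 - (1 - expi x * w))%C with (expi x * w)%C by ring.
  rewrite Cmod_mult, Cmod_expi, Cmod_1. lra. }
set (k := fun (w : C) (x : R) => (1 + - (1) * / (1 - expi x * w))%C).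
assert (Hk : forall w, Cmod w < / 2 ->
  continuation (Csphere_inv w) = continuation_of (k w)).
{ intros w Hw. unfold continuation. apply continuation_of_ext. intros x _.
  assert (H1 : (1 - expi x * w)%C <> RtoC 0).
  { apply Cmod_gt_0. generalize (Hdist w x Hw). lra. }
  unfold Csphere_inv, k. destruct (Ceq_dec w 0) as [->|Hw0]; cbn [sphere_kernel].
  - field.
  - unfold kernel.
    assert (Hx : expi (- x) = (/ expi x)%C).
    { transitivity ((expi (- x) * expi x) * / expi x)%C.
      - field. apply expi_neq_0.
      - rewrite <- expi_plus, Rplus_opp_l, expi_0. ring. }
    rewrite Hx. field.
    repeat split; try assumption; try apply expi_neq_0.
    intros E. apply H1. rewrite <- Copp_0, <- E. ring. }
apply (holomorphic_at_intro _ _ (/ 2)); [lra | ]. intros w Hw.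
replace (w - 0)%C with w in Hw by ring.
apply (ex_derive_ext_loc (K := C_AbsRing) (V := C_NormedModule) (fun w => continuation_of (k w))).
- assert (He : 0 < / 2 - Cmod w) by lra.
  exists (mkposreal _ He). intros v Hv. change (Cmod (v - w)%C < / 2 - Cmod w) in Hv.
  symmetry. apply Hk. generalize (Cmod_sub_le v w). lra.
- assert (Hcst : forall u, smooth_family beta gamma (fun _ _ => u) w (fun _ => 0)).
  { intros u. apply (smooth_const beta gamma beta_le_gamma _ _ (Cmod u));
      [intros x _; apply Ccont_const | intros; lra]. }
  eapply continuation_of_derivable. unfold k.
  apply smooth_plus; [apply Hcst | ]. apply smooth_mult; [apply Hcst | ].
  apply (smooth_resolvent beta gamma expi w (/ 2)).
  + lra.
  + intros x _. apply Ccont_expi.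
  + apply Cmod_expi.
  + intros x _. now apply Hdist.
Qed.

End Continuation.

(** Corrected by [b 0 * x ^ 2 / 2], the second primitive has vanishing second
    differences on the arc, hence is affine there; this is what the continuation
    is built from. *)
Lemma reflectionless_of_hat_vanishes b A alpha beta :
  (forall n, Cmod (b n) <= A) -> alpha < beta <= alpha + 2 * PI ->
  (forall t h, 0 <= h -> alpha <= t - h -> t + h <= beta ->
     sums (two_sided (fun n => b n * hat_moment t h n)%C) 0) ->
  reflectionless b (open_arc alpha beta).
Proof.
intros HA Hab Hvan. split; [now exists A | ].
destruct (second_diff_zero_affine
  (fun x => prim b x + (b 0%Z / 2) * (RtoC x * RtoC x))%C alpha beta ltac:(lra)) as (c & d & Hcd).
- intros x. apply Ccont_plus; [now apply Ccont_prim with A | ].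
  apply Ccont_mult; [apply Ccont_const | ].
  apply Ccont_mult; eapply Cderiv_cont, Cderiv_id.
- intros t h Hh H1 H2.
  generalize (prim_second_diff b A HA t h Hh (Hvan t h Hh H1 H2)). unfold second_diff.
  intros H. rewrite RtoC_plus, RtoC_minus.
  transitivity ((prim b (t + h)%R - 2 * prim b t + prim b (t - h)%R) + b 0%Z * RtoC (h ^ 2))%C.
  + simpl (h ^ 2). rewrite !RtoC_mult. field.
  + rewrite H. ring.
- assert (Hprim : forall x, alpha <= x <= beta ->
    prim b x = (c * x + d - b 0%Z * (RtoC x * RtoC x) / 2)%C).
  { intros x Hx. rewrite <- (Hcd x Hx). field. }
  exists (continuation b alpha beta c d). split; [ | split].
  + intros [z|] Hp.
    * now apply continuation_analytic_fin with A.
    * now apply continuation_analytic_inf with A.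
  + intros z Hz. now apply continuation_inside with A.
  + intros [z|] Hp.
    * now apply continuation_outside with A.
    * rewrite continuation_inf by assumption. cbn [f_minus]. ring.
Qed.

Theorem theorem1p4 :
  forall (a : nat -> C) (alpha beta : R),
    bounded_seq a ->
    alpha < beta <= alpha + 2 * PI ->
    (exists M : R, forall r : R, 0 < r < 1 ->
       RInt (fun theta => Cmod (Cpower_series a (r * expi theta)%C) / (2 * PI))
         alpha beta <= M) ->
    forall b : Z -> C, right_limit a b -> reflectionless b (open_arc alpha beta).
Proof.
intros a alpha beta [A HA] Hab [M HM] b Hb.
apply (reflectionless_of_hat_vanishes b A alpha beta).
- apply (right_limit_bound a A HA b Hb).
- exact Hab.
- intros t h Hh H1 H2.
  now apply (right_limit_hat_vanishes a A HA t h Hh alpha beta (conj H1 H2) M HM b).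
Qed.
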